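(* Let $G$ be a bounded domain in a real Hilbert space $H$, let $p\in G$, let $\Lambda\subset H$ be a real two-dimensional linear subspace, and write $p=p_\Lambda+p_\perp$ with $p_\Lambda\in\Lambda$, $p_\perp\perp\Lambda$, $a=|p_\Lambda|$, $b=|p_\perp|$. Assume that for some $c>0$ $$G\cap(p+\Lambda)=\{p_\perp+v:v\in\Lambda,\ |v|<c\},$$ and put $s=a/c$. Then for every $F=P[\Phi_F]\in\mathcal F_G^{\mathrm n}(p,\Lambda)$, $$I_s^c(\Phi_F)=c\,\|dF_0\|+2csa+(1+s^2)b^2 .$$ Consequently, $$\sigma_G(p,\Lambda)=c\,M_G(p,\Lambda)+2csa+(1+s^2)b^2 .$$ The derivative extremal problem defining $M_G(p,\Lambda)$ and the boundary-pairing problem defining $\sigma_G(p,\Lambda)$ induce the same ordering within the normalized class: for $F_1,F_2\in\mathcal F_G^{\mathrm n}(p,\Lambda)$, $\|d(F_1)_0\|\le\|d(F_2)_0\|$ if and only if $I_s^c(\Phi_{F_1})\le I_s^c(\Phi_{F_2})$. In particular, a sequence $(F_j)$ in $\mathcal F_G^{\mathrm n}(p,\Lambda)$ satisfies $\|d(F_j)_0\|\to M_G(p,\Lambda)$ if and only if $I_s^c(\Phi_{F_j})\to\sigma_G(p,\Lambda)$, and a member of the normalized class attains one supremum if and only if it attains the other.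
   Context: $\mathbb D$ is the open unit disk in $\mathbb C$, $\mathbb T=\partial\mathbb D$, $m$ is normalized Lebesgue measure on $\mathbb T$. A $C^2$ map $F:\mathbb D\to H$ is harmonic if $\Delta F=0$. For $\Phi\in L^1(\mathbb T,H)$ the (Bochner) Poisson integral is $P[\Phi](re^{i\theta})=\int_{\mathbb T}\frac{1-r^2}{1-2r\cos(\theta-t)+r^2}\Phi(e^{it})\,dm$. Every bounded harmonic $F:\mathbb D\to H$ has a unique (a.e.) boundary function $\Phi_F\in L^\infty(\mathbb T,H)$ with $F=P[\Phi_F]$. $\|dF_0\|$ is the operator norm of the real differential $dF_0:\mathbb R^2\to H$; a nonzero $dF_0$ is conformal if $|dF_0v|=\lambda|v|$ for all $v\in\mathbb R^2$, for some $\lambda>0$. $\mathcal F_G(p,\Lambda)$ is the set of harmonic maps $F:\mathbb D\to G$ with $F(0)=p$, $dF_0\neq0$ conformal, and $dF_0(\mathbb R^2)=\Lambda$; and $M_G(p,\Lambda)=\sup\{\|dF_0\|:F\in\mathcal F_G(p,\Lambda)\}$. Choose an orthonormal basis $e_1,e_2$ of $\Lambda$ with $p_\Lambda=ae_1$ ($e_1$ arbitrary if $a=0$). $\mathcal F_G^{\mathrm n}(p,\Lambda)$ is the set of $F\in\mathcal F_G(p,\Lambda)$ with $F_x(0)=\lambda e_1$, $F_y(0)=\lambda e_2$, $\lambda=\|dF_0\|>0$. For $0\le s<1$ let $\mathcal M_s(\zeta)=\frac{s+\zeta}{1+s\zeta}$, $w_s(z)=|1+sz|^2$, $E_s^c(\zeta)=p_\perp+c\operatorname{Re}\mathcal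 M_s(\zeta)e_1+c\operatorname{Im}\mathcal M_s(\zeta)e_2$, and $$I_s^c(\Phi)=\int_{\mathbb T}w_s(z)\langle\Phi(z),E_s^c(z)\rangle\,dm(z).$$ Finally $\sigma_G(p,\Lambda)=\sup\{I_s^c(\Phi_F):F\in\mathcal F_G^{\mathrm n}(p,\Lambda)\}$ (no absolute value). *)

(* Defs.v *)
From HB Require Import structures.
From mathcomp Require Import all_boot all_order all_algebra.
From mathcomp Require Import sesquilinear complex.
From mathcomp Require Import all_classical all_reals all_analysis.
Import Order.TTheory GRing.Theory Num.Theory.
Import numFieldNormedType.Exports.

Set Implicit Arguments.
Unset Strict Implicit.
Unset Printing Implicit Defensive.

Local Open Scope classical_set_scope.
Local Open Scope ring_scope.
Local Open Scope complex_scope.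

(** A real Hilbert space is a complete normed module [H] over [R] together with
    a symmetric positive definite bilinear form inducing its norm. *)
Definition induces_norm (R : realType) (H : normedModType R)
    (ip : {dot H for @idfun R}) : Prop :=
  forall x : H, ip x x = `|x| ^+ 2.

Section Bochner.
Context {R : realType} {H : normedModType R} {d : measure_display}
  {T : measurableType d}.
Variables (mu : {measure set T -> \bar R}) (D : set T).

Definition bochner_simple (g : T -> H) : Prop :=
  [/\ finite_set (range g),
      forall y, measurable (g @^-1` [set y])
    & forall y, y != 0 -> (mu (D `&` g @^-1` [set y]) < +oo)%E].

Definition simple_integral (g : T -> H) : H :=
  \sum_(y \in range g) fine (mu (D `&` g @^-1` [set y])) *: y.

(** Convergence is required at every point of [D], so that [f] is genuinely
    measurable and not only equal a.e. to a measurable function: a class modulo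
    a.e. equality is represented by such an [f], which always exists. *)
Definition strongly_measurable (f : T -> H) : Prop :=
  exists g : nat -> T -> H, (forall n, bochner_simple (g n)) /\
    forall t, D t -> g n t @[n --> \oo] --> f t.

(** [f] is Bochner integrable on [D], with integral [v]. *)
Definition bochner_integral (f : T -> H) (v : H) : Prop :=
  exists g : nat -> T -> H,
    [/\ forall n, bochner_simple (g n),
        forall t, D t -> g n t @[n --> \oo] --> f t,
        (\int[mu]_(t in D) `|f t - g n t|%:E)%E @[n --> \oo] --> 0%E
      & simple_integral (g n) @[n --> \oo] --> v].

Definition ess_bounded (f : T -> H) : Prop :=
  exists M : R, {ae mu, forall t, D t -> `|f t| <= M}.

End Bochner.

Section Disk.
Context {R : realType} {H : completeNormedModType R}.
Implicit Types (F : R * R -> H) (G L : set H) (p : H).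

(** The norm of the library on [R * R] is the sup norm. *)
Definition enorm (v : R * R) : R := Num.sqrt (v.1 ^+ 2 + v.2 ^+ 2).

(** Maps on the disk are total functions on the plane; only their values on
    [disk] matter. *)
Definition disk : set (R * R) := [set z | enorm z < 1].

Definition ex : R * R := (1, 0).
Definition ey : R * R := (0, 1).

(** [C^2]: [F] and all its directional derivatives are differentiable, and the
    second order directional derivatives are continuous. *)
Definition C2_on_disk F : Prop := forall z, disk z ->
  differentiable F z /\
  forall v : R * R, differentiable ('D_v F) z /\
  forall w : R * R, {for z, continuous ('D_w ('D_v F))}.

Definition laplacian F (z : R * R) : H :=
  'D_ex ('D_ex F) z + 'D_ey ('D_ey F) z.

Definition harmonic F : Prop :=
  C2_on_disk F /\ forall z, disk z -> laplacian F z = 0.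

Definition opnorm (A : R * R -> H) : R :=
  sup [set `|A v| | v in [set v | enorm v <= 1]].

Definition dF0 F : R * R -> H := 'd F (0 : R * R).

Definition conformal (A : R * R -> H) : Prop :=
  exists2 lam : R, 0 < lam & forall v, `|A v| = lam * enorm v.

Definition classF G p L : set (R * R -> H) :=
  [set F | [/\ harmonic F, forall z, disk z -> G (F z) & F 0 = p] /\
           [/\ exists v, dF0 F v != 0, conformal (dF0 F)
             & range (dF0 F) = L]].

Definition M_sup G p L : \bar R :=
  ereal_sup [set (opnorm (dF0 F))%:E | F in classF G p L].

Definition classFn G p L (e1 e2 : H) : set (R * R -> H) :=
  [set F | classF G p L F /\
    [/\ 0 < opnorm (dF0 F), 'D_ex F 0 = opnorm (dF0 F) *: e1
      & 'D_ey F 0 = opnorm (dF0 F) *: e2]].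

(** Functions on the unit circle are functions on [R[i]], read through
    [t |-> e^(it)] on [angles]; thus [dm = dt / (2 pi)]. *)
Definition angles : set R := `[0, 2 * pi]%classic.
Definition cis (t : R) : R[i] := cos t +i* sin t.

Definition Linfty_circle (Phi : R[i] -> H) : Prop :=
  strongly_measurable lebesgue_measure angles (Phi \o cis) /\
  ess_bounded lebesgue_measure angles (Phi \o cis).

Definition poisson_kernel (r theta t : R) : R :=
  (1 - r ^+ 2) / (1 - 2 * r * cos (theta - t) + r ^+ 2).

(** [F = P[Phi]] on the disk. *)
Definition is_poisson F (Phi : R[i] -> H) : Prop :=
  forall r theta : R, 0 <= r < 1 ->
    bochner_integral lebesgue_measure angles
      (fun t => ((2 * pi)^-1 * poisson_kernel r theta t) *: Phi (cis t))
      (F (r * cos theta, r * sin theta)).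

(** [Phi] is a representative of the boundary function of [F]. *)
Definition boundary_fun F (Phi : R[i] -> H) : Prop :=
  Linfty_circle Phi /\ is_poisson F Phi.

Definition moebius (s : R) (z : R[i]) : R[i] := (s%:C + z) / (1 + s%:C * z).

Definition weight (s : R) (z : R[i]) : R := ComplexField.Normc.normc (1 + s%:C * z) ^+ 2.

Definition E_map (pT e1 e2 : H) (s c : R) (z : R[i]) : H :=
  pT + (c * complex.Re (moebius s z)) *: e1
     + (c * complex.Im (moebius s z)) *: e2.

Definition I_pairing (ip : H -> H -> R) (pT e1 e2 : H) (s c : R)
    (Phi : R[i] -> H) : R :=
  (2 * pi)^-1 * (\int[lebesgue_measure]_(t in angles)
     (weight s (cis t) * ip (Phi (cis t)) (E_map pT e1 e2 s c (cis t))))%R.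

Definition sigma_sup (ip : H -> H -> R) G p L (pT e1 e2 : H) (s c : R) : \bar R :=
  ereal_sup [set y | exists F Phi,
    [/\ classFn G p L e1 e2 F, boundary_fun F Phi
      & y = (I_pairing ip pT e1 e2 s c Phi)%:E]].

Definition lin_plane L : Prop := exists u v : H,
  (forall x y : R, x *: u + y *: v = 0 -> x = 0 /\ y = 0) /\
  L = [set w | exists x y : R, w = x *: u + y *: v].

Definition orthonormal_basis (ip : H -> H -> R) L (e1 e2 : H) : Prop :=
  [/\ ip e1 e1 = 1, ip e2 e2 = 1, ip e1 e2 = 0
    & L = [set w | exists x y : R, w = x *: e1 + y *: e2]].

Definition bounded_domain G : Prop :=
  [/\ open G, connected G, G !=set0 & bounded_set G].

End Disk.

(* Main.v *)
Require Import Defs.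
From HB Require Import structures.
From mathcomp Require Import all_boot all_order all_algebra.
From mathcomp Require Import sesquilinear complex.
From mathcomp Require Import all_classical all_reals all_analysis.
From mathcomp Require Import measurable_realfun ring lra.
Import Order.TTheory GRing.Theory Num.Theory.
Import numFieldNormedType.Exports.

(** On the unit circle [w_s(z) M_s(z) = (s + z)(1 + s conj(z)) = 2 s + z + s^2 conj(z)],
    so the weighted test map [w_s E_s] is a trigonometric polynomial of degree
    one, and [I] only sees the mean and the two first Fourier coefficients of
    [Phi].  When [F = P[Phi]] these are [F(0) = p], [F_x(0) / 2] and
    [F_y(0) / 2], that is [lambda e1 / 2] and [lambda e2 / 2] for a normalized
    [F].  Orthogonality of [p_perp] to the plane then leaves
    [I = c lambda + constant] ([pairing_identity]).  As [c > 0], everything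
    that concerns normalized maps with a boundary function follows at once.

    The equality of suprema needs two more facts, because the derivative
    problem ranges over all of the class, while the pairing problem ranges over
    the normalized maps that come with a boundary function.  First, composing
    with the linear isometry of the plane that turns [dF_0] into a multiple of
    the frame [(e1, e2)] keeps the map harmonic and in [G], and keeps the norm
    of its differential ([class_normalize]).  Second, a bounded harmonic map
    into a Hilbert space is the Poisson integral of a bounded boundary function
    ([bounded_harmonic_boundary_fun]), which is the main part of the file.

    The existence of boundary values rests on one observation: for two harmonic
    maps [U] and [V] on the disk, the integral of
    [<U(r e^(it)), V(rho e^(it))>] over a period depends only on the product
    [r rho] ([RI_scale]).  This is Green's formula ([RI_green]): along
    [r rho = constant] the derivative of that integral is a boundary term of
    Green's formula, which vanishes.  It is used twice.
    - With [V] the Poisson kernel, and letting the kernel concentrate at a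
      point, it gives the Poisson formula on smaller circles
      ([poisson_formula]).
    - With [U = V = F] it shows that the energy [e(r)], the integral of
      [|F(r e^(it))|^2], satisfies
      [0 <= |F_x - F_(x s^2)|^2 = e(x) + e(x s^2) - 2 e(x s)] in the mean
      square.  So [e] is convex in [log r]; being bounded, it is nondecreasing
      and converges as [r] tends to 1, and the circles [F_r] form a Cauchy
      family in mean square.  Along radii that converge fast enough, the limit
      exists almost everywhere ([fast_radii], [radial_limit_boundary_fun]).

    Integrals of maps into [H] are handled weakly, by pairing with vectors:
    [ip_bochner_integral] reads a Bochner integral as a family of scalar
    integrals, and [bochner_integral_intro] goes back. *)

Set Implicit Arguments.
Unset Strict Implicit.
Unset Printing Implicit Defensive.

Local Open Scope classical_set_scope.
Local Open Scope ring_scope.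

(** * Derivatives of products, and the inner product *)

Section ProductRule.
Context {R : realType} {U V W : normedModType R}.
Variable b : U -> V -> W.
Hypothesis bBl : forall x y z, b (x - y) z = b x z - b y z.
Hypothesis bBr : forall x y z, b x (y - z) = b x y - b x z.
Hypothesis bZl : forall (k : R) x y, b (k *: x) y = k *: b x y.
Hypothesis bZr : forall (k : R) x y, b x (k *: y) = k *: b x y.
Hypothesis b_cvg : forall (F : set_system R), Filter F -> forall f g x y,
  f @ F --> x -> g @ F --> y -> (fun t => b (f t) (g t)) @ F --> b x y.

(** One rule for the inner product, the scaling and the product of reals: the
    difference quotient of [b (f t) (g t)] splits by bilinearity, and continuity of
    [b] lets each part converge. *)
Lemma is_derive_product (f : R -> U) (g : R -> V) (x : R) df dg :
  is_derive x (1 : R) f df -> is_derive x (1 : R) g dg ->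
  is_derive x (1 : R) (fun t => b (f t) (g t)) (b df (g x) + b (f x) dg).
Proof.
move=> [f1 <-] [g1 <-].
have cg : {for x, continuous g}.
  by apply: differentiable_continuous; apply/derivable1_diffP.
have h : (fun h => h^-1 *: (((fun t => b (f t) (g t)) \o shift x) (h *: (1 : R)) - b (f x) (g x)))
   @ 0^' --> b ('D_1 f x) (g x) + b (f x) ('D_1 g x).
  have -> : (fun h => h^-1 *: (((fun t => b (f t) (g t)) \o shift x) (h *: (1 : R)) - b (f x) (g x)))
   = (fun h => b (h^-1 *: ((f \o shift x) (h *: (1 : R)) - f x)) ((g \o shift x) (h *: (1 : R))) +
       b (f x) (h^-1 *: ((g \o shift x) (h *: (1 : R)) - g x))).
    apply/funext => h /=; rewrite bZl bZr bBl bBr -scalerDr; congr (_ *: _).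
    by rewrite addrA subrK.
  have sh : (g \o shift x) (h *: (1 : R)) @[h --> 0^'] --> g x.
    apply: (@cvg_comp _ _ _ (fun h : R => h *: (1 : R) + x) g _ (nbhs x)) cg.
    have : (fun h : R => h *: (1 : R) + x) @ (0 : R) --> x.
      have -> : (fun h : R => h *: (1 : R) + x) = (fun h => h + x).
        by apply/funext => h; rewrite [_ *: _]mulr1.
      rewrite -[X in _ --> X]add0r.
      by apply: cvgD; [exact: cvg_id|exact: cvg_cst].
    by apply: cvg_trans; apply: cvg_app; exact: cvg_within.
  by apply: cvgD; apply: b_cvg => //; exact: cvg_cst.
split.
  by apply/cvg_ex; eexists; exact: h.
exact/cvg_lim/h.
Qed.

End ProductRule.

Section ScalarCalculus.
Context {R : realType} {V : normedModType R}.

Lemma is_derive_scale (k : R -> R) (f : R -> V) (x : R) dk df :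
  is_derive x (1 : R) k dk -> is_derive x (1 : R) f df ->
  is_derive x (1 : R) (fun t => k t *: f t) (dk *: f x + k x *: df).
Proof.
apply: is_derive_product => [y z w|y z w|c y z|c y z|].
- exact: scalerBl.
- exact: scalerBr.
- by rewrite -scalerA.
- by rewrite !scalerA mulrC.
- by move=> *; exact: cvgZ.
Qed.

Lemma is_derive_mul (f g : R -> R) (x : R) df dg :
  is_derive x (1 : R) f df -> is_derive x (1 : R) g dg ->
  is_derive x (1 : R) (fun t => f t * g t) (df * g x + f x * dg).
Proof.
apply: is_derive_product => [y z w|y z w|c y z|c y z|].
- exact: mulrBl.
- exact: mulrBr.
- by rewrite [in RHS]/GRing.scale/= -mulrA.
- by rewrite /GRing.scale/= mulrCA.
- by move=> *; exact: cvgM.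
Qed.

Lemma is_derive_add (f g : R -> V) (x : R) df dg :
  is_derive x (1 : R) f df -> is_derive x (1 : R) g dg ->
  is_derive x (1 : R) (fun t => f t + g t) (df + dg).
Proof. by move=> ? ?; exact: is_deriveD. Qed.

Lemma is_derive_opp (f : R -> V) (x : R) df :
  is_derive x (1 : R) f df -> is_derive x (1 : R) (fun t => - f t) (- df).
Proof. by move=> ?; exact: is_deriveN. Qed.

Lemma is_derive_scalel (k : R) (f : R -> V) (x : R) df :
  is_derive x (1 : R) f df -> is_derive x (1 : R) (fun t => k *: f t) (k *: df).
Proof. by move=> ?; exact: is_deriveZ. Qed.

Lemma is_derive_const (v : V) (x : R) : is_derive x (1 : R) (fun=> v) 0.
Proof. exact: is_derive_cst. Qed.

Lemma is_derive_var (x : R) : is_derive x (1 : R) (fun t : R => t) (1 : R).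
Proof. exact: is_derive_id. Qed.

Lemma is_derive_chain (f : R -> V) (k : R -> R) (x : R) df dk :
  is_derive (k x) (1 : R) f df -> is_derive x (1 : R) k dk ->
  is_derive x (1 : R) (fun t => f (k t)) (dk *: df).
Proof.
move=> [/derivable1_diffP f1 <-] [/derivable1_diffP k1 <-].
have d : differentiable (f \o k) x by exact: differentiable_comp.
split; first exact/derivable1_diffP.
by rewrite -[LHS]/('D_1 (f \o k) x) !deriveE// diff_comp//= -[X in 'd f _ X]mulr1 linearZ.
Qed.

Lemma is_derive_inv (f : R -> R) (x : R) df : f x != 0 ->
  is_derive x (1 : R) f df ->
  is_derive x (1 : R) (fun t => (f t)^-1) (- (f x) ^- 2 * df).
Proof.
move=> f0 [f1 <-]; split; first exact: derivableV.
by rewrite (deriveV f0 f1).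
Qed.

Lemma is_derive_continuous (f : R -> V) (x : R) df :
  is_derive x (1 : R) f df -> {for x, continuous f}.
Proof.
by move=> [f1 _]; apply: differentiable_continuous; apply/derivable1_diffP.
Qed.

End ScalarCalculus.

Section InnerProduct.
Context {R : realType} {H : completeNormedModType R}.
Variable ip : {dot H for @idfun R}.
Hypothesis hip : induces_norm ip.

Lemma ipC x y : ip x y = ip y x.
Proof. by rewrite (hermitian_subproof x y) expr0 mul1r. Qed.

Lemma ipDl x y z : ip (x + y) z = ip x z + ip y z.
Proof. by rewrite linearDl. Qed.

Lemma ipZl k x z : ip (k *: x) z = k * ip x z.
Proof. by rewrite linearZl_LR. Qed.

Lemma ipDr x y z : ip z (x + y) = ip z x + ip z y.
Proof. by rewrite ipC ipDl !(ipC _ z). Qed.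

Lemma ipZr k x z : ip z (k *: x) = k * ip z x.
Proof. by rewrite ipC ipZl (ipC _ z). Qed.

Lemma ipNl x z : ip (- x) z = - ip x z.
Proof. by rewrite -scaleN1r ipZl mulN1r. Qed.

Lemma ipNr x z : ip z (- x) = - ip z x.
Proof. by rewrite ipC ipNl (ipC _ z). Qed.

Lemma ipBl x y z : ip (x - y) z = ip x z - ip y z.
Proof. by rewrite ipDl ipNl. Qed.

Lemma ipBr x y z : ip z (x - y) = ip z x - ip z y.
Proof. by rewrite ipDr ipNr. Qed.

Lemma ip0l z : ip 0 z = 0.
Proof. by rewrite -(subrr z) ipBl subrr. Qed.

Lemma ip0r z : ip z 0 = 0.
Proof. by rewrite ipC ip0l. Qed.

Lemma ip_suml (I : Type) (r : seq I) (f : I -> H) z :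
  ip (\sum_(i <- r) f i) z = \sum_(i <- r) ip (f i) z.
Proof.
apply: (big_ind2 (fun x y => ip x z = y)); first exact: ip0l.
- by move=> ? ? ? ? <- <-; exact: ipDl.
- by [].
Qed.

(** Cauchy-Schwarz, from the nonnegative norm of
    [|y|^2 x - <x, y> y]. *)
Lemma ip_CS x y : `|ip x y| <= `|x| * `|y|.
Proof.
have [->|y0] := eqVneq y 0; first by rewrite ip0r !normr0 mulr0.
have y1 : 0 < `|y| by rewrite normr_gt0.
rewrite -(@ler_pXn2r _ 2) ?nnegrE ?mulr_ge0// real_normK ?num_real//.
have : 0 <= `|(`|y| ^+ 2 *: x - ip x y *: y)| ^+ 2 by rewrite sqr_ge0.
rewrite -hip ipBl !ipBr !ipZl !ipZr !hip (ipC y x).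
set A := `|x|; set B := `|y|; set c := ip x y => h.
have : 0 <= B ^+ 2 * (A ^+ 2 * B ^+ 2 - c ^+ 2) by rewrite (le_trans h)// le_eqVlt; apply/orP; left; apply/eqP; ring.
by rewrite pmulr_rge0 ?exprn_gt0// subr_ge0 exprMn.
Qed.

Lemma ip_cvg (T : Type) (F : set_system T) (FF : Filter F) (f g : T -> H) x y :
  f @ F --> x -> g @ F --> y -> (fun t => ip (f t) (g t)) @ F --> ip x y.
Proof.
move=> fx gy; apply/subr_cvg0; apply: norm_cvg0.
have h : (fun t => `|f t - x| * `|g t| + `|x| * `|g t - y|) @ F --> (0 : R).
  have -> : (0 : R) = `|x - x| * `|y| + `|x| * `|y - y|.
    by rewrite !subrr !normr0 mul0r mulr0 addr0.
  by apply: cvgD; [apply: cvgM|apply: cvgMr]; 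
    try (apply: cvg_norm => //; apply: cvgB => //; exact: cvg_cst); exact: cvg_norm.
apply: (squeeze_cvgr _ (cvg_cst 0) h).
near=> t; rewrite normr_ge0/=.
have -> : ip (f t) (g t) - ip x y = ip (f t - x) (g t) + ip x (g t - y).
  by rewrite ipBl ipBr; ring.
by rewrite (le_trans (ler_normD _ _))// lerD// ip_CS.
Unshelve. all: by end_near. Qed.

Lemma ip_continuous_at (T : topologicalType) (f g : T -> H) x :
  {for x, continuous f} -> {for x, continuous g} ->
  {for x, continuous (fun t => ip (f t) (g t))}.
Proof. exact: ip_cvg. Qed.

Lemma ip_is_derive (f g : R -> H) (x : R) df dg :
  is_derive x (1 : R) f df -> is_derive x (1 : R) g dg ->
  is_derive x (1 : R) (fun t => ip (f t) (g t)) (ip df (g x) + ip (f x) dg).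
Proof.
apply: is_derive_product => [y z w|y z w|k y z|k y z|].
- exact: ipBl.
- exact: ipBr.
- exact: ipZl.
- exact: ipZr.
- by move=> *; exact: ip_cvg.
Qed.

End InnerProduct.

(** * Integrals over a period *)

Instance ae_lebesgue_filter (R : realType) :
  Filter (almost_everywhere (@lebesgue_measure R)).
Proof. exact: ae_filter_ringOfSetsType. Qed.

Section BoundedMeasurable.
Context {R : realType}.
Local Notation mu := (@lebesgue_measure R).
Implicit Types f g : R -> R.
Local Notation angles := (@angles R).

Lemma measurable_angles : measurable angles.
Proof. exact: measurable_itv. Qed.

Lemma mu_angles : mu angles = (2 * pi)%:E.
Proof.
rewrite /angles lebesgue_measure_itv/= lte_fin mulr_gt0 ?pi_gt0//.
by rewrite oppr0 adde0.
Qed.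

Lemma mu_angles_lty : (mu angles < +oo)%E.
Proof. by rewrite mu_angles ltry. Qed.

(** Essentially bounded and measurable on a period: a class stable under sums and
    products, all of whose members are integrable.  It contains the scalar
    products of a boundary function with vectors, which are bounded only almost
    everywhere. *)
Definition ebm f := measurable_fun angles f /\
  exists M : R, {ae mu, forall t, angles t -> `|f t| <= M}.

Lemma ebm_integrable f : ebm f -> mu.-integrable angles (EFin \o f).
Proof.
move=> [mf [M fM]]; apply/integrableP; split; first exact/(measurable_EFinP).
apply: (@le_lt_trans _ _ (`|M|%:E * mu angles)%E).
  apply: integral_le_bound => //; first exact: measurable_angles.
    exact/(measurable_EFinP).
  move: fM; apply: filterS => t h /h; rewrite /= lee_fin => /le_trans; apply.
  exact: ler_norm.
by rewrite mu_angles -EFinM ltry.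
Qed.

Lemma bounded_ebm f M : measurable_fun angles f ->
  (forall t, angles t -> `|f t| <= M) -> ebm f.
Proof. by move=> mf fM; split => //; exists M; apply: aeW. Qed.

Lemma continuous_bounded_angles f : continuous f ->
  exists M, forall t, angles t -> `|f t| <= M.
Proof.
move=> cf.
have /compact_bounded[M [_ hM]] : compact (f @` angles).
  apply: continuous_compact; first exact: continuous_subspaceT.
  exact: segment_compact.
exists (M + 1) => t at_; apply: (hM (M + 1)); first by rewrite ltrDl.
by exists t.
Qed.

Lemma continuous_ebm f : continuous f -> ebm f.
Proof.
move=> cf; have [M fM] := continuous_bounded_angles cf.
apply: (bounded_ebm (M := M)) => //; apply: measurable_funTS.
exact: continuous_measurable_fun.
Qed.

Lemma ebm_cst k : ebm (fun=> k).
Proof. by apply: continuous_ebm; exact: cst_continuous. Qed.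

Lemma ebmD f g : ebm f -> ebm g -> ebm (fun t => f t + g t).
Proof.
move=> [mf [M fM]] [mg [N gN]]; split; first exact: measurable_funD.
exists (M + N); move: fM gN; apply: filterS2 => t hf hg at_.
by rewrite (le_trans (ler_normD _ _))// lerD ?hf ?hg.
Qed.

Lemma ebmM f g : ebm f -> ebm g -> ebm (fun t => f t * g t).
Proof.
move=> [mf [M fM]] [mg [N gN]]; split; first exact: measurable_funM.
exists (M * N); move: fM gN; apply: filterS2 => t hf hg at_.
by rewrite normrM ler_pM ?hf ?hg.
Qed.

Lemma ebmZ k f : ebm f -> ebm (fun t => k * f t).
Proof. by move=> hf; apply: ebmM => //; exact: ebm_cst. Qed.

Lemma ebmN f : ebm f -> ebm (fun t => - f t).
Proof.
by move=> /(ebmZ (-1)) h; under eq_fun do rewrite -mulN1r.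
Qed.

Lemma ebmB f g : ebm f -> ebm g -> ebm (fun t => f t - g t).
Proof. by move=> hf /ebmN hg; exact: ebmD. Qed.

Lemma ebm_norm f : ebm f -> ebm (fun t => `|f t|).
Proof.
move=> [mf [M fM]]; split; first exact: measurableT_comp.
by exists M; move: fM; apply: filterS => t h /h; rewrite normr_id.
Qed.

(** The mean over the circle is [(2 * pi)^-1 * RI f]. *)
Definition RI f : R := (\int[mu]_(t in angles) f t)%R.

Lemma RI_D f g : ebm f -> ebm g -> RI (fun t => f t + g t) = RI f + RI g.
Proof.
move=> /ebm_integrable hf /ebm_integrable hg.
by rewrite /RI; apply: RintegralD => //; exact: measurable_angles.
Qed.

Lemma RI_B f g : ebm f -> ebm g -> RI (fun t => f t - g t) = RI f - RI g.
Proof.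
move=> /ebm_integrable hf /ebm_integrable hg.
by rewrite /RI; apply: RintegralB => //; exact: measurable_angles.
Qed.

Lemma RI_Z k f : ebm f -> RI (fun t => k * f t) = k * RI f.
Proof.
by move=> /ebm_integrable hf; rewrite /RI; rewrite RintegralZl//; exact: measurable_angles.
Qed.

Lemma RI_cst k : RI (fun=> k) = 2 * pi * k.
Proof.
rewrite /RI Rintegral_cst; last exact: measurable_angles.
by rewrite mulrC -[(2 * pi)%R]/(fine (2 * pi)%:E) -mu_angles.
Qed.

Lemma eq_RI f g : (forall t, angles t -> f t = g t) -> RI f = RI g.
Proof. by move=> fg; apply: eq_Rintegral => t /set_mem /fg. Qed.

Lemma RI_le f g : ebm f -> ebm g -> (forall t, angles t -> f t <= g t) ->
  RI f <= RI g.
Proof.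
move=> /ebm_integrable hf /ebm_integrable hg.
move=> fg; rewrite /RI; have := @le_Rintegral _ _ R mu angles f g measurable_angles hf hg fg. exact.
Qed.

Lemma RI_ge0 f : (forall t, angles t -> 0 <= f t) -> 0 <= RI f.
Proof. by move=> f0; rewrite /RI fine_ge0 // integral_ge0. Qed.

Lemma RI_norm f : ebm f -> `|RI f| <= RI (fun t => `|f t|).
Proof.
by move=> /ebm_integrable hf; rewrite /RI; apply: le_normr_Rintegral => //; exact: measurable_angles.
Qed.

Lemma RI_norm_le f M : ebm f -> (forall t, angles t -> `|f t| <= M) ->
  `|RI f| <= 2 * pi * M.
Proof.
move=> hf fM; rewrite (le_trans (RI_norm hf))// -RI_cst RI_le//.
  exact: ebm_norm.
exact: ebm_cst.
Qed.

Lemma RI_EFin f : ebm f -> (\int[mu]_(t in angles) (f t)%:E)%E = (RI f)%:E.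
Proof.
move=> /ebm_integrable hf; rewrite /RI /Rintegral fineK//.
by have := @integrable_fin_num _ _ R mu angles measurable_angles _ hf.
Qed.

Lemma RI_period_derivative f df : continuous df ->
  (forall t, is_derive t (1 : R) f (df t)) -> f (2 * pi) = f 0 -> RI df = 0.
Proof.
move=> cdf dfE fper.
have cf : continuous f.
  move=> t; apply: differentiable_continuous; apply/derivable1_diffP.
  by have [] := dfE t.
apply: EFin_inj; rewrite -RI_EFin; last exact: continuous_ebm.
rewrite (@continuous_FTC2 _ df f 0 (2 * pi)) ?mulr_gt0 ?pi_gt0//.
- by rewrite -EFinB fper subrr.
- exact: continuous_subspaceT.
- split.
  + by move=> t _; have [] := dfE t.
  + exact/cvg_at_right_filter/cf.
  + exact/cvg_at_left_filter/cf.
- by move=> t _; rewrite derive1E; have [_] := dfE t.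
Qed.

End BoundedMeasurable.

(** * Simple maps into a Hilbert space *)

Section Bochner.
Context {R : realType}.
Local Notation mu := (@lebesgue_measure R).
Local Notation angles := (@angles R).

Lemma cvgEFin (T : Type) (F : set_system T) (FF : Filter F) (u : T -> R) a :
  u @ F --> a -> (u x)%:E @[x --> F] --> a%:E.
Proof. by move=> ua; apply: cvg_EFin => //; exact: nearW. Qed.

Lemma measurable_fun_cvgR (f_ : nat -> R -> R) (f : R -> R) :
  (forall n, measurable_fun angles (f_ n)) ->
  (forall t, angles t -> f_ ^~ t @ \oo --> f t) -> measurable_fun angles f.
Proof.
move=> mf cf; apply/measurable_EFinP.
apply: (emeasurable_fun_cvg (fun n => EFin \o f_ n)) => [n|t /cf ft].
  by apply/measurable_EFinP; exact: mf.
exact: cvgEFin.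
Qed.

(** Bounded convergence.  The limit holds only almost everywhere, because radial
    limits do. *)
Lemma RI_cvg (f_ : nat -> R -> R) f M :
  (forall n, measurable_fun angles (f_ n)) -> ebm f ->
  (forall n t, angles t -> `|f_ n t| <= M) ->
  {ae mu, forall t, angles t -> f_ ^~ t @ \oo --> f t} ->
  RI (f_ n) @[n --> \oo] --> RI f.
Proof.
move=> mf hf fM cf.
have [|||||_ _] := @dominated_convergence _ _ R mu angles measurable_angles
  (fun n => EFin \o f_ n) (EFin \o f) (EFin \o (fun=> M)).
- by move=> n; apply/measurable_EFinP; exact: mf.
- by apply/measurable_EFinP; case: hf.
- by apply: filterS cf => t h /h; exact: cvgEFin.
- exact: (ebm_integrable (ebm_cst M)).
- by apply: aeW => t n at_; rewrite lee_fin fM.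
by rewrite RI_EFin// => /fine_cvg.
Qed.

(** Stated for any set of values, as it is also needed for a pair of simple maps. *)
Lemma finite_fibers_measurable (Y : choiceType) (g : R -> Y) (phi : Y -> R) :
  finite_set (range g) -> (forall y, measurable (g @^-1` [set y])) ->
  measurable_fun angles (phi \o g).
Proof.
move=> fg mg; apply: measurable_funTS => _ B mB; rewrite setTI.
rewrite (_ : _ @^-1` B = \bigcup_(y in range g `&` phi @^-1` B) (g @^-1` [set y])).
  by apply: fin_bigcup_measurable => //; exact: finite_setIl.
apply/seteqP; split => [t Bt|t [y [_ By] gy]].
  by exists (g t) => //; split => //; exists t.
by rewrite /preimage/= gy.
Qed.

Context {H : completeNormedModType R}.
Local Notation simple := (bochner_simple mu angles : (R -> H) -> Prop).

Lemma bochner_simple_intro (g : R -> H) : finite_set (range g) ->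
  (forall y, measurable (g @^-1` [set y])) -> simple g.
Proof.
move=> fg mg; split => // y _; apply: le_lt_trans mu_angles_lty.
have mA := @measurable_angles R.
apply: le_measure; rewrite ?inE; [exact: (measurableI _ _ mA (mg y))|exact: mA|exact: subIsetl].
Qed.

Lemma simple_measurable (g : R -> H) (phi : H -> R) : simple g ->
  measurable_fun angles (fun t => phi (g t)).
Proof. by move=> [fg mg _]; exact: finite_fibers_measurable. Qed.

Lemma simple_measurable2 (g k : R -> H) (phi : H -> H -> R) :
  simple g -> simple k -> measurable_fun angles (fun t => phi (g t) (k t)).
Proof.
move=> [fg mg _] [fk mk _].
apply: (@finite_fibers_measurable _ (fun t => (g t, k t))
  (fun p : H * H => phi p.1 p.2)).
  apply: (sub_finite_set _ (finite_setX fg fk)) => _ [t _ <-].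
  by split; exists t.
move=> [y z]; rewrite (_ : _ @^-1` _ = g @^-1` [set y] `&` k @^-1` [set z]).
  by apply: measurableI; [exact: mg|exact: mk].
by apply/seteqP; split => t /= [-> ->].
Qed.

Lemma simple_bounded (g : R -> H) : simple g -> exists M, forall t, `|g t| <= M.
Proof.
move=> [fg _ _]; have /finite_seqP[s sE] := fg.
exists (\sum_(y <- s) `|y|) => t.
have : g t \in s by have : range g (g t) by [exists t]; rewrite sE.
elim: s {sE} => // y s ih; rewrite inE big_cons => /orP[/eqP ->|/ih h].
  by rewrite lerDl sumr_ge0.
by rewrite (le_trans h)// lerDr.
Qed.

(** The Hilbert space carries no sigma-algebra here, so measurability of
    [phi (f t) (k t)] is obtained as that of a limit of functions with finitely
    many values. *)
Lemma simple_limit_measurable2 (g_ : nat -> R -> H) (f k : R -> H)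
    (phi : H -> H -> R) :
  (forall n, simple (g_ n)) -> simple k ->
  (forall t, angles t -> g_ n t @[n --> \oo] --> f t) ->
  (forall y, continuous (phi ^~ y)) ->
  measurable_fun angles (fun t => phi (f t) (k t)).
Proof.
move=> sg sk gf cphi.
apply: (@measurable_fun_cvgR (fun n t => phi (g_ n t) (k t))) => [n|t at_].
  exact: simple_measurable2.
by have := cvg_comp _ _ (gf t at_) (cphi (k t) (f t)).
Qed.

Lemma strongly_measurable_continuous (f : R -> H) (phi : H -> R) :
  strongly_measurable mu angles f -> continuous phi ->
  measurable_fun angles (fun t => phi (f t)).
Proof.
move=> [g_ [sg gf]] cphi.
apply: (@measurable_fun_cvgR (fun n t => phi (g_ n t))) => [n|t at_].
  exact: simple_measurable.
by have := cvg_comp _ _ (gf t at_) (cphi (f t)).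
Qed.

Lemma RI_sum (I : Type) (s : seq I) (f : I -> R -> R) :
  (forall i, ebm (f i)) ->
  ebm (fun t => \sum_(i <- s) f i t) /\
  RI (fun t => \sum_(i <- s) f i t) = \sum_(i <- s) RI (f i).
Proof.
move=> hf; elim: s => [|i s [h1 h2]].
  under eq_fun do rewrite big_nil.
  by rewrite big_nil RI_cst mulr0; split => //; exact: ebm_cst.
under eq_fun do rewrite big_cons.
by rewrite big_cons -h2 RI_D//; split => //; exact: ebmD.
Qed.

Variable ip : {dot H for @idfun R}.
Hypothesis hip : induces_norm ip.

Lemma ip_continuousl (h : H) : continuous (fun x => ip x h).
Proof. by move=> x; apply: ip_cvg => //; exact: cvg_cst. Qed.

Lemma simple_ebm (g : R -> H) h : simple g -> ebm (fun t => ip (g t) h).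
Proof.
move=> sg; have [M gM] := simple_bounded sg.
apply: (@bounded_ebm _ _ (M * `|h|)); first exact: (@simple_measurable _ (ip^~ h)).
by move=> t _; rewrite (le_trans (ip_CS _ _ _))// ler_wpM2r.
Qed.

(** A pairing with a fixed vector commutes with a finite sum. *)
Lemma ip_simple_integral (g : R -> H) h : simple g ->
  ip (simple_integral mu angles g) h = RI (fun t => ip (g t) h).
Proof.
move=> sg; have [fg mg _] := sg.
rewrite /simple_integral fsbig_finite// ip_suml.
transitivity (\sum_(y <- finmap.enum_fset (fset_set (range g)))
    RI (fun t => ip y h * \1_(g @^-1` [set y]) t)).
  apply: eq_bigr => y _; rewrite ipZl RI_Z; last first.
    apply: (@bounded_ebm _ _ 1); first by apply: measurable_indic; exact: mg.
    by move=> t _; rewrite indicE; case: (_ \in _); rewrite ?normr1 ?normr0.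
  rewrite mulrC; congr (_ * _); rewrite /RI /Rintegral integral_indic//.
  - by rewrite setIC.
  - exact: measurable_angles.
rewrite -(proj2 (RI_sum _ _)); last first.
  move=> y; apply: ebmZ; apply: (@bounded_ebm _ _ 1); first by apply: measurable_indic; exact: mg.
  by move=> t _; rewrite indicE; case: (_ \in _); rewrite ?normr1 ?normr0.
apply: eq_RI => t _.
under eq_bigr do rewrite mulrC -ipZl.
rewrite -ip_suml; congr (ip _ h).
have gin : g t \in finmap.enum_fset (fset_set (range g)).
  by apply: eq_trans (in_fset_set fg (g t)) _; apply/mem_set; exists t.
rewrite (bigD1_seq _ gin (finmap.fset_uniq _))/=.
rewrite indicE mem_set// scale1r big1 ?addr0// => y /eqP yg.
by rewrite indicE memNset ?scale0r// => /esym.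
Qed.

End Bochner.

(** * Bochner integrals through scalar integrals *)

Section BochnerWeak.
Context {R : realType} {H : completeNormedModType R}.
Local Notation mu := (@lebesgue_measure R).
Local Notation angles := (@angles R).
Local Notation simple := (bochner_simple mu angles : (R -> H) -> Prop).
Variable ip : {dot H for @idfun R}.
Hypothesis hip : induces_norm ip.

Lemma measurable_simple_error (g_ : nat -> R -> H) (f k : R -> H) :
  (forall n, simple (g_ n)) -> simple k ->
  (forall t, angles t -> g_ n t @[n --> \oo] --> f t) ->
  measurable_fun angles (fun t => `|f t - k t|).
Proof.
move=> sg sk gf.
apply: (@simple_limit_measurable2 R H g_ f k (fun x y => `|x - y|)) => //.
move=> y x; apply: cvg_norm; apply: cvgB => //; exact: cvg_cst.
Qed.

(** By [ip_simple_integral] the claim holds for simple maps; it passes to the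
    limit since the error is at most [|h|] times the integral of [|f - g_n|]. *)
Lemma ip_bochner_integral (f : R -> H) v h :
  bochner_integral mu angles f v -> ebm (fun t => ip (f t) h) ->
  RI (fun t => ip (f t) h) = ip v h.
Proof.
move=> [g_ [sg gf err gv]] hf.
have c1 : ip (simple_integral mu angles (g_ n)) h @[n --> \oo] --> ip v h.
  by have := cvg_comp _ _ gv (ip_continuousl hip (x := v)); exact.
have hd n : ebm (fun t => ip (f t - g_ n t) h).
  under eq_fun do rewrite ipBl.
  by apply: ebmB => //; exact: (simple_ebm hip).
have c2 : ip (simple_integral mu angles (g_ n)) h @[n --> \oo] -->
    RI (fun t => ip (f t) h).
  apply/cvgrPdist_le => e e0.
  have e1 : 0 < e / (`|h| + 1) by rewrite divr_gt0// ltr_wpDl.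
  have /fine_cvgP[fin_err] := err.
  move=> /cvgrPdist_le /(_ _ e1) small.
  near=> n.
  rewrite ip_simple_integral// -RI_B//; last exact: (simple_ebm hip).
  have -> : RI (fun t => ip (f t) h - ip (g_ n t) h) = RI (fun t => ip (f t - g_ n t) h).
    by apply: eq_RI => t _; rewrite ipBl.
  rewrite -lee_fin (le_trans (_ : _ <= (RI (fun t => `|ip (f t - g_ n t) h|))%:E)%E)//.
    by rewrite lee_fin RI_norm.
  rewrite -RI_EFin; last exact: ebm_norm.
  have mE := measurable_simple_error sg (sg n) gf.
  apply: (@le_trans _ _ (\int[mu]_(t in angles) (`|h|%:E * `|f t - g_ n t|%:E))%E).
    apply: ge0_le_integral => //.
    - exact: measurable_angles.
    - by apply/measurable_EFinP; case: (ebm_norm (hd n)).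
    - apply/measurable_EFinP; apply: measurable_funM => //; exact: measurable_cst.
    - by move=> t _; rewrite -EFinM lee_fin mulrC ip_CS.
  have mE' : measurable_fun angles (fun t => `|f t - g_ n t|%:E).
    exact/measurable_EFinP.
  rewrite (ge0_integralZl_EFin mu measurable_angles _ mE')//.
  have fn : (\int[mu]_(t in angles) `|f t - g_ n t|%:E)%E \is a fin_num.
    by near: n.
  rewrite -(fineK fn) -EFinM lee_fin.
  have : `|0 - fine (\int[mu]_(t in angles) `|f t - g_ n t|%:E)%E| <= e / (`|h| + 1).
    by near: n.
  rewrite sub0r normrN => /(le_trans (ler_norm _)) le1.
  rewrite (le_trans (ler_wpM2l (normr_ge0 h) le1))//.
  rewrite mulrCA ger_pMr// ler_pdivrMr ?ltr_wpDl// mul1r lerDl//.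
by apply: (cvg_unique _ c2 c1).
Unshelve. all: by end_near. Qed.

(** Weak values determine the integral: for [w] the difference between [v] and the
    integral of [g_n], the square [|w|^2] is the integral of [<f - g_n, w>], hence
    at most [|w|] times the integral of [|f - g_n|], which tends to 0 by bounded
    convergence. *)
Lemma bochner_integral_intro (g_ : nat -> R -> H) (f : R -> H) v M :
  (forall n, simple (g_ n)) ->
  (forall t, angles t -> g_ n t @[n --> \oo] --> f t) ->
  (forall n t, angles t -> `|g_ n t| <= M) ->
  (forall h, RI (fun t => ip (f t) h) = ip v h) ->
  bochner_integral mu angles f v.
Proof.
move=> sg gf gM weak.
have fM t : angles t -> `|f t| <= M.
  move=> at_; have c : `|g_ n t| @[n --> \oo] --> `|f t| by apply: cvg_norm; exact: gf.
  by rewrite -(cvg_lim _ c)//; apply: limr_le; [apply: cvgP c|apply: nearW => n; exact: gM].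
have mE n := measurable_simple_error sg (sg n) gf.
have bE n t : angles t -> `|f t - g_ n t| <= M + M.
  by move=> at_; rewrite (le_trans (ler_normB _ _))// lerD ?fM ?gM.
have eE n : ebm (fun t => `|f t - g_ n t|).
  by apply: (@bounded_ebm _ _ (M + M)) => // t /(bE n); rewrite normr_id.
have err : RI (fun t => `|f t - g_ n t|) @[n --> \oo] --> (0 : R).
  rewrite -[0](mulr0 (2 * pi : R)) -RI_cst.
  apply: (@RI_cvg _ _ _ (M + M)) => //; first exact: ebm_cst.
    by move=> n t /(bE n); rewrite normr_id.
  apply: aeW => t at_; rewrite -(normr0 H) -(subrr (f t)).
  by apply: cvg_norm; apply: cvgB; [exact: cvg_cst|exact: gf].
exists g_; split => //.
  by under eq_cvg do rewrite RI_EFin//; exact: cvgEFin.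
apply/cvgrPdist_le => e e0.
move/cvgrPdist_le: err => /(_ _ e0) err.
near=> n; set w := v - simple_integral mu angles (g_ n).
have mf : ebm (fun t => ip (f t) w).
  apply: (@bounded_ebm _ _ (M * `|w|)).
    apply: (@strongly_measurable_continuous _ _ f (ip^~ w)); last exact: ip_continuousl.
    by exists g_.
  by move=> t at_; rewrite (le_trans (ip_CS hip _ _))// ler_wpM2r// fM.
have wE : `|w| ^+ 2 = RI (fun t => ip (f t - g_ n t) w).
  rewrite -hip {1}/w ipBl -weak ip_simple_integral// -RI_B//; last exact: (simple_ebm hip).
  by apply: eq_RI => t _; rewrite ipBl.
have hd : ebm (fun t => ip (f t - g_ n t) w).
  by under eq_fun do rewrite ipBl; apply: ebmB => //; exact: (simple_ebm hip).
have le1 : `|w| ^+ 2 <= `|w| * RI (fun t => `|f t - g_ n t|).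
  rewrite wE -RI_Z// RI_le//; first exact: ebmZ.
  by move=> t _; rewrite (le_trans (ler_norm _))// mulrC ip_CS.
have le2 : RI (fun t => `|f t - g_ n t|) <= e.
  rewrite (le_trans (ler_norm _))// -normrN -sub0r.
  by near: n.
have [->|w0] := eqVneq w 0; first by rewrite normr0 ltW.
have w1 : 0 < `|w| by rewrite normr_gt0.
by move: le1; rewrite expr2 ler_pM2l// => /le_trans; apply.
Unshelve. all: by end_near. Qed.

End BochnerWeak.

(** * First Fourier coefficients of a boundary function *)

Section PoissonKernel.
Context {R : realType}.

Definition pden (r x : R) := 1 - 2 * r * cos x + r ^+ 2.

(** [pden r x] is [|1 - r e^(ix)|^2]: this is the reverse triangle inequality. *)
Lemma pden_lower r x : 0 <= r -> (1 - r) ^+ 2 <= pden r x.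
Proof.
move=> r0; rewrite -subr_ge0 /pden.
have -> : 1 - 2 * r * cos x + r ^+ 2 - (1 - r) ^+ 2 = 2 * (r * (1 - cos x)) by ring.
by rewrite !mulr_ge0// subr_ge0 cos_le1.
Qed.

Lemma pden_gt0 r x : 0 <= r < 1 -> 0 < pden r x.
Proof.
move=> /andP[r0 r1]; have := pden_lower x r0; apply: lt_le_trans.
by rewrite exprn_gt0// subr_gt0.
Qed.

Lemma continuous_poisson_kernel (r theta : R) : 0 <= r < 1 ->
  continuous (poisson_kernel r theta).
Proof.
move=> r01 t; apply: cvgM; first exact: cvg_cst.
apply: cvgV; first by rewrite gt_eqF// pden_gt0.
have cc : cos (theta - x) @[x --> t] --> cos (theta - t).
  apply: (@cvg_comp _ _ _ (fun x => theta - x) cos); last exact: continuous_cos.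
  by apply: cvgB; [exact: cvg_cst|exact: cvg_id].
apply: cvgD; last exact: cvg_cst.
apply: cvgB; first exact: cvg_cst.
by apply: cvgM => //; exact: cvg_cst.
Qed.

Lemma poisson_kernel0 (theta t : R) : poisson_kernel 0 theta t = 1 :> R.
Proof. by rewrite /poisson_kernel expr0n/= mulr0 mul0r !subr0 addr0 divr1. Qed.

(** The expansion [1 + 2 r cos(theta - t) + O(r^2)], whose remainder is
    uniform in [t], gives the derivative of a Poisson integral at the origin. *)
Lemma poisson_kernel_quotient (r theta t : R) : 0 < r <= 2^-1 ->
  exists2 k : R, `|k| <= 32 &
   poisson_kernel r theta t = 1 + r * (2 * cos (theta - t)) + r * r * k.
Proof.
move=> /andP[r0 r2]; set c := cos (theta - t).
have r01 : 0 <= r < 1 by lra.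
have D0 := pden_gt0 (theta - t) r01.
(* The numerator of k is at most 8, and the denominator at least (1 - r)^2 >= 1/4. *)
have D1 : 4^-1 <= pden r (theta - t).
  apply: le_trans (pden_lower _ (ltW r0)); nra.
exists ((4 * c ^+ 2 - 2 - 2 * r * c) / pden r (theta - t)); last first.
  rewrite /poisson_kernel -/(pden r (theta - t)).
  have := lt0r_neq0 D0; rewrite /pden -/c => h.
  by field.
have c1 : `|c| <= 1 by rewrite ler_norml cos_geN1 cos_le1.
rewrite normrM normfV (gtr0_norm D0) ler_pdivrMr//.
have : `|4 * c ^+ 2 - 2 - 2 * r * c| <= 8.
  move: c1; rewrite !ler_norml => /andP[? ?]; nra.
by move=> /le_trans; apply; lra.
Qed.

End PoissonKernel.

Section FirstMoments.
Context {R : realType} {H : completeNormedModType R}.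
Variable ip : {dot H for @idfun R}.
Hypothesis hip : induces_norm ip.
Variables (F : R * R -> H) (Phi : R[i] -> H).
Hypothesis FPhi : boundary_fun F Phi.

Lemma boundary_ebm h : ebm (fun t => ip (Phi (cis t)) h).
Proof.
have [[sm [M bM]] _] := FPhi; split.
  apply: (@strongly_measurable_continuous _ _ _ (ip^~ h)) => //.
  exact: ip_continuousl.
exists (M * `|h|); apply: filterS bM => t b /b Pt.
by rewrite (le_trans (ip_CS hip _ _))// ler_wpM2r.
Qed.

Lemma poisson_weak h r theta : 0 <= r < 1 ->
  (2 * pi)^-1 * RI (fun t => poisson_kernel r theta t * ip (Phi (cis t)) h) =
  ip (F (r * cos theta, r * sin theta)) h.
Proof.
move=> r01; have [_ /(_ r theta r01) bi] := FPhi.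
have e : ebm (fun t => poisson_kernel r theta t * ip (Phi (cis t)) h).
  apply: ebmM; last exact: boundary_ebm.
  by apply: continuous_ebm; exact: continuous_poisson_kernel.
rewrite -(ip_bochner_integral hip bi); last first.
  under eq_fun do rewrite ipZl -mulrA.
  exact: ebmZ.
rewrite -RI_Z//; apply: eq_RI => t _.
by rewrite ipZl mulrA.
Qed.

Lemma boundary_mean h :
  (2 * pi)^-1 * RI (fun t => ip (Phi (cis t)) h) = ip (F 0) h.
Proof.
have := @poisson_weak h 0 0; rewrite !mul0r lexx ltr01 => <-//.
by congr (_ * _); apply: eq_RI => t _; rewrite poisson_kernel0 mul1r.
Qed.

(** The difference quotients of [F] at 0 in the direction [e^(i theta)] are Poisson
    integrals whose kernels converge uniformly to [2 cos(theta - t)]. *)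
Lemma boundary_first_moment h theta : differentiable F 0 ->
  (2 * pi)^-1 * RI (fun t => 2 * cos (theta - t) * ip (Phi (cis t)) h) =
  ip ('D_(cos theta, sin theta) F 0) h.
Proof.
move=> dF; set v := (cos theta, sin theta); set phi := fun t => ip (Phi (cis t)) h.
have ephi : ebm phi := boundary_ebm h.
have ecos : ebm (fun t => 2 * cos (theta - t) * phi t).
  apply: ebmM => //; apply: continuous_ebm => t.
  apply: cvgM; first exact: cvg_cst.
  apply: (@cvg_comp _ _ _ (fun x => theta - x) cos); last exact: continuous_cos.
  by apply: cvgB; [exact: cvg_cst|exact: cvg_id].
have key (r : R) : 0 < r <= 2^-1 ->
    `|(2 * pi)^-1 * RI (fun t => 2 * cos (theta - t) * phi t) -
      ip (r^-1 *: (F (r *: v) - F 0)) h| <= r * ((2 * pi)^-1 * (32 * RI (fun t => `|phi t|))).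
  move=> r2; have r0 : 0 < r by lra.
  have r01 : 0 <= r < 1 by lra.
  have ep : ebm (fun t => poisson_kernel r theta t * phi t).
    by apply: ebmM => //; apply: continuous_ebm; exact: continuous_poisson_kernel.
  have -> : ip (r^-1 *: (F (r *: v) - F 0)) h =
      (2 * pi)^-1 * RI (fun t => r^-1 * (poisson_kernel r theta t * phi t - phi t)).
    rewrite ipZl ipBl -boundary_mean -(poisson_weak h theta r01) RI_Z; last exact: ebmB.
    by rewrite RI_B// -/phi; ring.
  rewrite -mulrBr -RI_B//; last by apply: ebmZ; exact: ebmB.
  have p0 : 0 < (2 * pi)^-1 :> R by rewrite invr_gt0 mulr_gt0 ?pi_gt0.
  rewrite normrM gtr0_norm// mulrCA ler_pM2l//.
  have ed : ebm (fun t => 2 * cos (theta - t) * phi t - r^-1 * (poisson_kernel r theta t * phi t - phi t)).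
    by apply: ebmB => //; apply: ebmZ; exact: ebmB.
  rewrite (le_trans (RI_norm ed))// mulrA -RI_Z; last exact: ebm_norm.
  apply: RI_le; [exact: ebm_norm|by apply: ebmZ; exact: ebm_norm|].
  move=> t _; have [k k32 ->] := poisson_kernel_quotient theta t r2.
  rewrite [X in `|X|](_ : _ = - (r * k * phi t)); last by field; rewrite gt_eqF.
  by rewrite normrN !normrM (gtr0_norm r0) -!mulrA ler_pM2l// ler_wpM2r.
have lim1 : ip (r^-1 *: (F (r *: v) - F 0)) h @[r --> 0^'+] --> ip ('D_v F 0) h.
  apply: ip_cvg => //; last exact: cvg_cst.
  apply: (@cvg_dnbhs_at_right _ _ (fun r : R => r^-1 *: (F (r *: v) - F 0))).
  have := @diff_derivable _ _ _ _ _ v dF; rewrite /derivable /derive.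
  by under eq_fun do rewrite /= addr0.
have lim2 : ip (r^-1 *: (F (r *: v) - F 0)) h @[r --> 0^'+] -->
   (2 * pi)^-1 * RI (fun t => 2 * cos (theta - t) * phi t).
  apply/cvgrPdist_le => e e0.
  set C := _^-1 * (32 * _) in key.
  have C0 : 0 < `|C| + 1 by rewrite ltr_wpDl.
  near=> r.
  have r0 : 0 < r by [].
  have r2 : r <= 2^-1 by near: r; apply: nbhs_right_le; rewrite invr_gt0.
  rewrite (le_trans (key r _)) ?r0//.
  have : r <= e / (`|C| + 1) by near: r; apply: nbhs_right_le; rewrite divr_gt0.
  rewrite ler_pdivlMr// => /(le_trans _); apply.
  by rewrite ler_wpM2l ?ltW// (le_lt_trans (ler_norm C))// ltrDl.
by apply: cvg_unique lim2 lim1.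
Unshelve. all: by end_near. Qed.

End FirstMoments.

(** * The pairing identity *)

Section Pairing.
Context {R : realType} {H : completeNormedModType R}.
Variable ip : {dot H for @idfun R}.
Hypothesis hip : induces_norm ip.

Lemma weight_cis (s t : R) : weight s (cis t) = 1 + 2 * s * cos t + s ^+ 2.
Proof.
rewrite /weight /cis /= sqr_sqrtr ?addr_ge0 ?sqr_ge0//.
have := cos2Dsin2 t; set x := cos t; set y := sin t => xy.
suff -> : (1 + (s * x - 0 * y)) ^+ 2 + (0 + (s * y + 0 * x)) ^+ 2 =
  1 + 2 * s * x + s ^+ 2 * (x ^+ 2 + y ^+ 2) by rewrite xy mulr1.
by ring.
Qed.

(** The denominator of [M_s] cancels against [w_s = |1 + s z|^2]. *)
Lemma weight_moebius (s t : R) : 0 <= s < 1 ->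
  weight s (cis t) * complex.Re (moebius s (cis t)) = 2 * s + (1 + s ^+ 2) * cos t /\
  weight s (cis t) * complex.Im (moebius s (cis t)) = (1 - s ^+ 2) * sin t.
Proof.
move=> /andP[s0 s1]; rewrite weight_cis /moebius /cis /=.
have := cos2Dsin2 t; have := cos_geN1 t.
set x := cos t; set y := sin t => x1 xy.
have N0 : 0 < 1 + 2 * s * x + s ^+ 2.
  have : 0 < (1 - s) ^+ 2 by rewrite exprn_gt0// subr_gt0.
  nra.
have yE : y ^+ 2 = 1 - x ^+ 2 by rewrite -xy; ring.
have NE : (1 + (s * x - 0 * y)) ^+ 2 + (0 + (s * y + 0 * x)) ^+ 2 = 1 + 2 * s * x + s ^+ 2.
  have -> : (1 + (s * x - 0 * y)) ^+ 2 + (0 + (s * y + 0 * x)) ^+ 2 =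
    1 + 2 * s * x + s ^+ 2 * (x ^+ 2 + y ^+ 2) by ring.
  by rewrite xy mulr1.
rewrite NE; have := lt0r_neq0 N0; set N := 1 + _ + _ => N1.
split.
  transitivity ((s + x) * (1 + s * x) + s * y ^+ 2); first by field.
  by rewrite yE; ring.
by field.
Qed.

(** By [weight_moebius] the integrand combines the scalar products of [Phi] with
    [pT], [e1] and [e2] with coefficients 1, [cos t] and [sin t], so that its
    integral is given by [boundary_mean] and [boundary_first_moment]. *)
Lemma pairing_identity (F : R * R -> H) (Phi : R[i] -> H) (pT e1 e2 : H) (a c s N : R) :
  boundary_fun F Phi -> differentiable F 0 -> F 0 = a *: e1 + pT ->
  'D_ex F 0 = N *: e1 -> 'D_ey F 0 = N *: e2 ->
  ip e1 e1 = 1 -> ip e2 e2 = 1 -> ip pT e1 = 0 -> ip pT e2 = 0 -> 0 <= s < 1 ->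
  I_pairing ip pT e1 e2 s c Phi =
    c * N + (2 * c * s * a + (1 + s ^+ 2) * ip pT pT).
Proof.
move=> FPhi dF F0 Fx Fy e11 e22 p1 p2 s01.
pose phi h t := ip (Phi (cis t)) h.
have ephi h : ebm (phi h) := boundary_ebm hip FPhi h.
have mean h := boundary_mean hip FPhi h.
have momc h : (2 * pi)^-1 * RI (fun t => 2 * cos t * phi h t) = ip (N *: e1) h.
  have := boundary_first_moment hip FPhi h 0 dF; rewrite cos0 sin0 -/ex Fx => <-.
  by congr (_ * _); apply: eq_RI => t _; rewrite sub0r cosN.
have moms h : (2 * pi)^-1 * RI (fun t => 2 * sin t * phi h t) = ip (N *: e2) h.
  have := boundary_first_moment hip FPhi h (pi / 2) dF.
  rewrite cos_pihalf sin_pihalf -/ey Fy => <-.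
  by congr (_ * _); apply: eq_RI => t _; rewrite cosB cos_pihalf sin_pihalf; ring.
have ec h : ebm (fun t => 2 * cos t * phi h t).
  apply: ebmM => //; apply: continuous_ebm => t.
  by apply: cvgM; [exact: cvg_cst|exact: continuous_cos].
have es h : ebm (fun t => 2 * sin t * phi h t).
  apply: ebmM => //; apply: continuous_ebm => t.
  by apply: cvgM; [exact: cvg_cst|exact: continuous_sin].
have -> : I_pairing ip pT e1 e2 s c Phi = (2 * pi)^-1 * RI (fun t =>
    (1 + s ^+ 2) * phi pT t + s * (2 * cos t * phi pT t)
    + (c * (2 * s)) * phi e1 t + (c * (1 + s ^+ 2) / 2) * (2 * cos t * phi e1 t)
    + (c * (1 - s ^+ 2) / 2) * (2 * sin t * phi e2 t)).
  rewrite /I_pairing; congr (_ * _); apply: eq_RI => t _.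
  have [wr wi] := weight_moebius t s01.
  rewrite /E_map; move: wr wi; rewrite !weight_cis.
  move: (complex.Re _) (complex.Im _) => re im; set w := 1 + _ + _ => wr wi.
  rewrite !ipDr !ipZr -/(phi pT t) -/(phi e1 t) -/(phi e2 t).
  rewrite (mulrDr w) (mulrDr w (phi pT t)).
  have -> : w * (c * re * phi e1 t) = c * (w * re) * phi e1 t by ring.
  have -> : w * (c * im * phi e2 t) = c * (w * im) * phi e2 t by ring.
  by rewrite wr wi /w; field.
do 4 (rewrite RI_D; [|by do ?[apply: ebmD]; apply: ebmZ|by apply: ebmZ]).
rewrite !RI_Z//.
move: ((2 * pi)^-1) mean momc moms => q mean momc moms.
rewrite !(mulrDr q) !(mulrCA q) !mean !momc !moms.
rewrite F0 !ipZl !ipDl !ipZl e11 e22 p1 (ipC _ e1 pT) p1.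
by field.
Qed.

End Pairing.

(** * Integrals that do not depend on a parameter *)

Section ConstantIntegral.
Context {R : realType}.
Local Notation mu := (@lebesgue_measure R).
Local Notation angles := (@angles R).

Lemma joint_bounded (V : normedModType R) (h : R * R -> V) (al be : R) :
  (forall x t, al <= x <= be -> {for (x, t), continuous h}) ->
  exists M, forall x t, al <= x <= be -> angles t -> `|h (x, t)| <= M.
Proof.
move=> ch.
have cK : compact ((`[al, be]%classic : set R) `*` angles).
  by apply: compact_setX; exact: segment_compact.
have /compact_bounded[M [_ hM]] : compact (h @` (`[al, be]%classic `*` angles)).
  apply: continuous_compact => //; apply: continuous_in_subspaceT => -[x t] /set_mem[/= xab _].
  by apply: ch; move: xab; rewrite /= in_itv.
exists (M + 1) => x t xab at_; apply: (hM (M + 1)); first by rewrite ltrDl.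
by exists (x, t) => //; split => //=; rewrite in_itv.
Qed.

(** Differentiation under the integral sign.  The bound on [g] also gives the
    continuity of the integral up to the end points. *)
Lemma RI_const (f g : R -> R -> R) (al be : R) : al < be ->
  (forall x t, al <= x <= be -> is_derive x (1 : R) (f ^~ t) (g x t)) ->
  (exists M, forall x t, al <= x <= be -> angles t -> `|g x t| <= M) ->
  (forall x, al <= x <= be -> ebm (f x)) ->
  (forall x, al < x < be -> RI (g x) = 0) ->
  RI (f al) = RI (f be).
Proof.
move=> ab df [M gM] ef g0.
have M0 : 0 <= M.
  apply: le_trans (gM al 0 _ _) => //; first by rewrite lexx ltW.
  by rewrite /Defs.angles /= in_itv/= lexx mulr_ge0 ?pi_ge0.
have lip x y : al <= x -> x <= y -> y <= be -> `|RI (f y) - RI (f x)| <= 2 * pi * (M * (y - x)).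
  move=> ax xy yb.
  have xab : al <= x <= be by rewrite ax (le_trans xy).
  have yab : al <= y <= be by rewrite yb (le_trans ax).
  rewrite -RI_B; [|exact: ef..].
  apply: RI_norm_le; first by apply: ebmB; exact: ef.
  move=> t at_.
  have [||c cxy ->] := @MVT_segment R (f ^~ t) (g ^~ t) x y xy.
  - move=> z; rewrite in_itv/= => /andP[xz zy].
    by apply: df; rewrite (le_trans ax (ltW xz)) (le_trans (ltW zy) yb).
  - apply: derivable_within_continuous => z; rewrite in_itv/= => /andP[xz zy].
    by have [] := df z t; rewrite ?(le_trans ax xz) ?(le_trans zy yb).
  - rewrite normrM (ger0_norm (x := y - x)) ?subr_ge0// ler_wpM2r ?subr_ge0// gM//.
    by move: cxy; rewrite in_itv/= => /andP[xc cy]; rewrite (le_trans ax xc) (le_trans cy yb).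
have cont : {within `[al, be], continuous (fun x => RI (f x))}.
  apply/subspace_continuousP => x /=; rewrite in_itv/= => /andP[ax xb].
  apply/cvgrPdist_le => e e0.
  have C0 : 0 < 2 * pi * M + 1 by rewrite ltr_wpDl// !mulr_ge0 ?pi_ge0.
  have d0 : 0 < e / (2 * pi * M + 1) by rewrite divr_gt0.
  near=> y.
  have yab : y \in `[al, be] by near: y; exact: withinT.
  have xy : `|x - y| <= e / (2 * pi * M + 1).
    near: y; rewrite near_withinE.
    have : \forall y \near x, `|x - y| <= e / (2 * pi * M + 1).
      by apply: (@cvgr_dist_le _ _ _ (nbhs x) _ id x) => //; exact: cvg_id.
    by apply: filterS => y h _.
  move: yab; rewrite in_itv/= => /andP[ay yb].
  apply: (@le_trans _ _ (2 * pi * M * `|x - y|)).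
    have [le|/ltW le] := leP x y.
      have -> : `|x - y| = y - x by rewrite distrC ger0_norm ?subr_ge0.
      by rewrite distrC -[leRHS]mulrA; exact: lip.
    have -> : `|x - y| = x - y by rewrite ger0_norm ?subr_ge0.
    by rewrite -[leRHS]mulrA; exact: lip.
  apply: (@le_trans _ _ ((2 * pi * M + 1) * `|x - y|)).
    by rewrite ler_wpM2r// lerDl.
  by rewrite mulrC -ler_pdivlMr.
have der x : x \in `]al, be[ -> is_derive x (1 : R) (fun x => RI (f x)) 0.
  rewrite in_itv/= => /andP[ax xb].
  have intf y : `]al, be[%classic y -> mu.-integrable angles (EFin \o f y).
    rewrite /= in_itv/= => /andP[ay yb]; apply: ebm_integrable.
    by apply: ef; rewrite !ltW.
  have derf y t : `]al, be[%classic y -> angles t -> derivable (f ^~ t) y 1.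
    rewrite /= in_itv/= => /andP[ay yb] _.
    by have [] := df y t; rewrite ?ltW.
  have pE y t : al < y < be -> partial1of2 f y t = g y t.
    move=> /andP[ay yb]; rewrite partial1of2E.
    by have [] := df y t; rewrite ?ltW.
  have bnd y t : `]al, be[%classic y -> angles t -> `|partial1of2 f y t| <= M.
    rewrite /= in_itv/= => /andP[ay yb] at_.
    by rewrite pE ?ay// gM// !ltW.
  have xI : `]al, be[%classic x by rewrite /= in_itv/= ax.
  have iM : mu.-integrable angles (EFin \o (fun=> M)) by exact: (ebm_integrable (ebm_cst M)).
  have mA := @measurable_angles R.
  split.
    exact: (@derivable_under_integral R _ _ mu f angles mA x al be xI intf derf (fun=> M) (fun=> M0) iM bnd).
  rewrite -derive1E.
  rewrite (@differentiation_under_integral R _ _ mu f angles mA x al be xI intf derf (fun=> M) (fun=> M0) iM bnd).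
  rewrite -(g0 x) ?ax//; apply: eq_RI => t _.
  by rewrite pE// ax.
have [c _] := MVT ab der cont.
by rewrite mul0r => /subr0_eq.
Unshelve. all: by end_near. Qed.

End ConstantIntegral.

(** * Green's formula in polar coordinates *)

Section PolarHarmonic.
Context {R : realType} {H : completeNormedModType R}.
Variable ip : {dot H for @idfun R}.
Hypothesis hip : induces_norm ip.
Local Notation angles := (@angles R).

Definition jointly_continuous (U : R -> R -> H) :=
  forall (r t : R), 0 <= r < 1 -> {for (r, t), continuous (fun p => U p.1 p.2)}.

(** Harmonicity of [(r, t) |-> U r t], read in polar coordinates together with the
    regularity that the Green formula needs.  The Poisson kernel is given by a
    formula in [r] and [t], so this form spares its Cartesian derivatives. *)
Record polar_harmonic (U Ur Ut Urr Utt : R -> R -> H) : Prop := PolarHarmonic {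
  ph_cont : jointly_continuous U;
  ph_contr : jointly_continuous Ur;
  ph_contrr : jointly_continuous Urr;
  ph_r : forall (r t : R), 0 <= r < 1 -> is_derive r (1 : R) (U ^~ t) (Ur r t);
  ph_rr : forall (r t : R), 0 <= r < 1 -> is_derive r (1 : R) (Ur ^~ t) (Urr r t);
  ph_t : forall (r t : R), 0 <= r < 1 -> is_derive t (1 : R) (U r) (Ut r t);
  ph_tt : forall (r t : R), 0 <= r < 1 -> is_derive t (1 : R) (Ut r) (Utt r t);
  ph_laplace : forall (r t : R), 0 <= r < 1 ->
    Utt r t = - (r ^+ 2 *: Urr r t + r *: Ur r t);
  ph_per : forall r : R, 0 <= r < 1 -> U r (2 * pi) = U r 0;
  ph_pert : forall r : R, 0 <= r < 1 -> Ut r (2 * pi) = Ut r 0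
}.

Lemma jointly_continuous_comp (U : R -> R -> H) (k : R -> R) x t :
  jointly_continuous U -> 0 <= k x < 1 -> {for x, continuous k} ->
  {for (x, t), continuous (fun p : R * R => U (k p.1) p.2)}.
Proof.
move=> cU kx ck.
apply: (@continuous2_cvg _ _ _ _ _ _ (fun p => k p.1) snd U (k x) t (cU _ _ kx)); last exact: cvg_snd.
by apply: (@cvg_comp _ _ _ fst k) ck; exact: cvg_fst.
Qed.

Lemma jointly_continuous_right (U : R -> R -> H) r :
  jointly_continuous U -> 0 <= r < 1 -> continuous (U r).
Proof.
by move=> cU r01 t; apply: (@continuous2_cvg _ _ _ _ _ _ (fun=> r) id U r t (cU r t r01)); [exact: cvg_cst|exact: cvg_id].
Qed.

Lemma continuous_ip (f g : R -> H) : continuous f -> continuous g ->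
  continuous (fun t => ip (f t) (g t)).
Proof. by move=> cf cg t; exact: (ip_continuous_at hip (cf t) (cg t)). Qed.

Section TwoFunctions.
Variables (U Ur Ut Urr Utt V Vr Vt Vrr Vtt : R -> R -> H).
Hypothesis hU : polar_harmonic U Ur Ut Urr Utt.
Hypothesis hV : polar_harmonic V Vr Vt Vrr Vtt.

Lemma continuous_tt (W Wr Wt Wrr Wtt : R -> R -> H) r :
  polar_harmonic W Wr Wt Wrr Wtt -> 0 <= r < 1 -> continuous (Wtt r).
Proof.
move=> hW r01.
have -> : Wtt r = fun t => - (r ^+ 2 *: Wrr r t + r *: Wr r t).
  by apply/funext => t; exact: ph_laplace hW _ _ _.
move=> t; apply: cvgN; apply: cvgD; apply: cvgZ; try exact: cvg_cst.
  exact: (jointly_continuous_right (ph_contrr hW) r01).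
exact: (jointly_continuous_right (ph_contr hW) r01).
Qed.

(** The integrand is the [t]-derivative of [<U, V_t> - <U_t, V>], which is
    periodic. *)
Lemma RI_angular_parts r rho : 0 <= r < 1 -> 0 <= rho < 1 ->
  RI (fun t => ip (U r t) (Vtt rho t) - ip (Utt r t) (V rho t)) = 0.
Proof.
move=> r01 rho01.
apply: (@RI_period_derivative _ (fun t => ip (U r t) (Vt rho t) - ip (Ut r t) (V rho t))).
- move=> t; apply: cvgB; apply: continuous_ip.
  + exact: (jointly_continuous_right (ph_cont hU)).
  + exact: (continuous_tt hV).
  + exact: (continuous_tt hU).
  + exact: (jointly_continuous_right (ph_cont hV)).
- move=> t.
  have d1 := ip_is_derive hip (ph_t hU t r01) (ph_tt hV t rho01).
  have d2 := ip_is_derive hip (ph_tt hU t r01) (ph_t hV t rho01).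
  have := is_derive_add d1 (is_derive_opp d2).
  by move=> d; apply: is_derive_eq; ring.
- by rewrite (ph_per hU r01) (ph_per hV rho01) (ph_pert hU r01) (ph_pert hV rho01).
Qed.

(** Let [W(l)] be the integral at radii [l r] and [l rho].  By the Laplace equation
    [l W'(l)] is the integral of [RI_angular_parts], so [W] is constant on
    [(0, 1]]; and [W(l) = O(l)] at 0. *)
Lemma RI_green (r rho : R) : 0 <= r < 1 -> 0 <= rho < 1 ->
  RI (fun t => r * ip (Ur r t) (V rho t) - rho * ip (U r t) (Vr rho t)) = 0.
Proof.
move=> r01 rho01.
have lr (k l : R) : 0 <= k < 1 -> 0 <= l <= 1 -> 0 <= l * k < 1.
  move=> /andP[k0 k1] /andP[l0 l1]; rewrite mulr_ge0//=.
  by rewrite (le_lt_trans _ k1)// ler_piMl.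
(* The integrand at radii l r and l rho is l * w l, with dw the l-derivative of w. *)
pose w (l t : R) : R := r * ip (Ur (l * r) t) (V (l * rho) t) -
  rho * ip (U (l * r) t) (Vr (l * rho) t).
pose dw (l t : R) : R := r * (ip (r *: Urr (l * r) t) (V (l * rho) t) +
    ip (Ur (l * r) t) (rho *: Vr (l * rho) t)) -
  rho * (ip (r *: Ur (l * r) t) (Vr (l * rho) t) +
    ip (U (l * r) t) (rho *: Vrr (l * rho) t)).
have cmul (k l : R) : {for l, continuous (fun x : R => x * k)}.
  by apply: cvgM; [exact: cvg_id|exact: cvg_cst].
have cj W (k l t : R) : jointly_continuous W -> 0 <= k < 1 -> 0 <= l <= 1 ->
    {for (l, t), continuous (fun p : R * R => W (p.1 * k) p.2)}.
  move=> cW k01 l01.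
  exact: (@jointly_continuous_comp W (fun x : R => x * k) l t cW (lr _ _ k01 l01) (cmul k l)).
have [[cU cUr] cUrr] := (ph_cont hU, ph_contr hU, ph_contrr hU).
have [[cV cVr] cVrr] := (ph_cont hV, ph_contr hV, ph_contrr hV).
have cw (l t : R) : 0 <= l <= 1 -> {for (l, t), continuous (fun p => w p.1 p.2)}.
  move=> l01; apply: cvgB; apply: cvgM; try exact: cvg_cst;
    by apply: (ip_continuous_at hip); exact: cj.
have cdw (l t : R) : 0 <= l <= 1 -> {for (l, t), continuous (fun p => dw p.1 p.2)}.
  move=> l01; apply: cvgB; apply: cvgM; try exact: cvg_cst;
    apply: cvgD; apply: (ip_cvg hip); try (apply: cvgZ; first exact: cvg_cst);
    exact: cj.
have cwr (l : R) : 0 <= l <= 1 -> continuous (w l).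
  move=> l01 t; apply: (@continuous2_cvg _ _ _ _ _ _ (fun=> l) id w l t (cw l t l01)).
    exact: cvg_cst.
  exact: cvg_id.
have [C hC] := joint_bounded (al := 0) (be := 1) (fun l t h => cw l t h).
have [D hD] := joint_bounded (al := 0) (be := 1) (fun l t h => cdw l t h).
have step (d : R) : 0 < d < 1 -> RI (fun t => d * w d t) = RI (fun t => 1 * w 1 t).
  move=> /andP[d0 d1].
  apply: (@RI_const _ (fun l t => l * w l t) (fun l t => 1 * w l t + l * dw l t)) => //.
  - move=> l t /andP[dl l1].
    have l01 : 0 <= l <= 1 by rewrite l1 (le_trans (ltW d0)).
    apply: (@is_derive_mul _ (fun l => l) (w ^~ t)).
    have dm (k : R) : is_derive l (1 : R) (fun x : R => x * k) k.
      have := is_derive_mul (is_derive_var l) (is_derive_const k l).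
      by move=> h; apply: is_derive_eq; rewrite mulr0 addr0 mul1r.
    have dU := is_derive_chain (k := fun x : R => x * r) (ph_r hU t (lr _ _ r01 l01)) (dm r).
    have dUr := is_derive_chain (k := fun x : R => x * r) (ph_rr hU t (lr _ _ r01 l01)) (dm r).
    have dV := is_derive_chain (k := fun x : R => x * rho) (ph_r hV t (lr _ _ rho01 l01)) (dm rho).
    have dVr := is_derive_chain (k := fun x : R => x * rho) (ph_rr hV t (lr _ _ rho01 l01)) (dm rho).
    have h1 := is_derive_mul (is_derive_const r l) (ip_is_derive hip dUr dV).
    have h2 := is_derive_mul (is_derive_const rho l) (ip_is_derive hip dU dVr).
    have := is_derive_add h1 (is_derive_opp h2).
    by rewrite !mul0r !add0r.
  - exists (C + D) => l t /andP[dl l1] at_.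
    have l01 : 0 <= l <= 1 by rewrite l1 (le_trans (ltW d0)).
    rewrite mul1r (le_trans (ler_normD _ _))// lerD ?(hC l t)// normrM.
    rewrite (le_trans _ (hD l t l01 at_))// ler_piMl// ger0_norm//.
    by case/andP: l01.
  - move=> l /andP[dl l1]; apply: ebmZ; apply: continuous_ebm; apply: cwr.
    by rewrite l1 (le_trans (ltW d0)).
  - move=> l /andP[dl l1].
    have l0 : 0 < l by rewrite (lt_trans d0).
    have l01 : 0 <= l <= 1 by rewrite !ltW.
    have p0 := RI_angular_parts (lr _ _ r01 l01) (lr _ _ rho01 l01).
    have -> : 0 = l^-1 * RI (fun t => ip (U (l * r) t) (Vtt (l * rho) t) -
        ip (Utt (l * r) t) (V (l * rho) t)) by rewrite p0 mulr0.
    rewrite -RI_Z; last first.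
      apply: continuous_ebm => t; apply: cvgB; apply: continuous_ip.
      + exact: (jointly_continuous_right cU (lr _ _ r01 l01)).
      + exact: (continuous_tt hV (lr _ _ rho01 l01)).
      + exact: (continuous_tt hU (lr _ _ r01 l01)).
      + exact: (jointly_continuous_right cV (lr _ _ rho01 l01)).
    apply: eq_RI => t _.
    rewrite (ph_laplace hU t (lr _ _ r01 l01)) (ph_laplace hV t (lr _ _ rho01 l01)).
    rewrite /w /dw !(ipNl, ipNr, ipDl, ipDr, ipZl, ipZr).
    by field; rewrite gt_eqF.
set I := RI _.
have IE : I = RI (fun t => 1 * w 1 t).
  by apply: eq_RI => t _; rewrite /w !mul1r.
have C0 : 0 <= C.
  apply: le_trans (hC 0 0 _ _); rewrite ?lexx ?ler01//.
  by rewrite /Defs.angles /= in_itv/= lexx mulr_ge0 ?pi_ge0.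
have small (d : R) : 0 < d < 1 -> `|I| <= d * (2 * pi * C).
  move=> d01; have /andP[d0 d1] := d01; rewrite IE -(step d d01) RI_Z; last first.
    by apply: continuous_ebm; apply: cwr; rewrite !ltW.
  rewrite normrM gtr0_norm// ler_pM2l//; apply: RI_norm_le.
    by apply: continuous_ebm; apply: cwr; rewrite !ltW.
  by move=> t at_; apply: hC => //; rewrite !ltW.
apply/eqP; rewrite -normr_le0; apply/ler_addgt0Pr => e e0; rewrite add0r.
have K0 : 0 < 2 * pi * C + 1 by rewrite ltr_wpDl// !mulr_ge0 ?pi_ge0.
pose d := Num.min (2^-1) (e / (2 * pi * C + 1)).
have d01 : 0 < d < 1.
  by rewrite /d lt_min gt_min invr_gt0 ltr0n divr_gt0//= invf_lt1 ?ltr1n.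
rewrite (le_trans (small d d01))//.
apply: (@le_trans _ _ (d * (2 * pi * C + 1))).
  by rewrite ler_wpM2l ?lerDl//; case/andP: d01 => /ltW.
by rewrite -ler_pdivlMr// /d ge_min lexx orbT.
Qed.

(** Move along the curve [x |-> (r x, rho tau / x)], on which the product of the
    radii is constant: the derivative of the integral is [x^-1] times the one of
    [RI_green]. *)
Lemma RI_scale (r rho tau : R) : 0 <= r < 1 -> 0 <= rho < 1 -> 0 < tau < 1 ->
  RI (fun t => ip (U (r * tau) t) (V rho t)) =
  RI (fun t => ip (U r t) (V (rho * tau) t)).
Proof.
move=> r01 rho01 /andP[tau0 tau1].
have [/andP[r0 r1] /andP[rho0 rho1]] := (r01, rho01).
have x0 (x : R) : tau <= x <= 1 -> 0 < x by move=> /andP[+ _]; exact: lt_le_trans.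
have k1 (x : R) : tau <= x <= 1 -> 0 <= r * x < 1.
  move=> h; have x_gt0 := x0 x h; have /andP[_ x1] := h.
  by rewrite mulr_ge0 ?(ltW x_gt0)//= (le_lt_trans _ r1)// ler_piMr.
have k2 (x : R) : tau <= x <= 1 -> 0 <= rho * tau / x < 1.
  move=> h; have x_gt0 := x0 x h; have /andP[x1 _] := h.
  apply/andP; split; first by rewrite divr_ge0 ?(ltW x_gt0)// mulr_ge0// ltW.
  by rewrite ltr_pdivrMr// mul1r (lt_le_trans _ x1)// gtr_pMl.
have c1 (x : R) : {for x, continuous (fun x : R => r * x)}.
  by apply: cvgM; [exact: cvg_cst|exact: cvg_id].
have c2 (x : R) : tau <= x <= 1 -> {for x, continuous (fun x : R => rho * tau / x)}.
  move=> /x0 h; apply: cvgM; first exact: cvg_cst.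
  by apply: cvgV; [rewrite gt_eqF|exact: cvg_id].
have j1 W (x t : R) : jointly_continuous W -> tau <= x <= 1 ->
    {for (x, t), continuous (fun p : R * R => W (r * p.1) p.2)}.
  move=> cW h; exact: (@jointly_continuous_comp W (fun x : R => r * x) x t cW (k1 x h) (c1 x)).
have j2 W (x t : R) : jointly_continuous W -> tau <= x <= 1 ->
    {for (x, t), continuous (fun p : R * R => W (rho * tau / p.1) p.2)}.
  move=> cW h.
  exact: (@jointly_continuous_comp W (fun x : R => rho * tau / x) x t cW (k2 x h) (c2 x h)).
have [cU cUr] := (ph_cont hU, ph_contr hU).
have [cV cVr] := (ph_cont hV, ph_contr hV).
pose f (x t : R) : R := ip (U (r * x) t) (V (rho * tau / x) t).
pose g (x t : R) : R := ip (r *: Ur (r * x) t) (V (rho * tau / x) t) +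
  ip (U (r * x) t) ((rho * tau * - x ^- 2) *: Vr (rho * tau / x) t).
have -> : RI (fun t => ip (U (r * tau) t) (V rho t)) = RI (f tau).
  by apply: eq_RI => t _; rewrite /f mulfK ?gt_eqF.
have -> : RI (fun t => ip (U r t) (V (rho * tau) t)) = RI (f 1).
  by apply: eq_RI => t _; rewrite /f mulr1 divr1.
apply: (@RI_const _ f g) => //.
- move=> x t h.
  have d1 : is_derive x (1 : R) (fun x : R => r * x) r.
    have := is_derive_mul (is_derive_const r x) (is_derive_var x).
    by move=> hh; apply: is_derive_eq; rewrite mul0r add0r mulr1.
  have d2 : is_derive x (1 : R) (fun x => rho * tau / x) (rho * tau * - x ^- 2).
    have xn0 : x != 0 by rewrite gt_eqF// x0.
    have := is_derive_mul (is_derive_const (rho * tau) x) (is_derive_inv (f := id) xn0 (is_derive_var x)).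
    by move=> hh; apply: is_derive_eq; rewrite mul0r add0r mulr1.
  have dU := is_derive_chain (k := fun x : R => r * x) (ph_r hU t (k1 x h)) d1.
  have dV := is_derive_chain (k := fun x : R => rho * tau / x) (ph_r hV t (k2 x h)) d2.
  exact: (ip_is_derive hip dU dV).
- apply: (@joint_bounded _ _ (fun p => g p.1 p.2)) => x t h.
  have cxx : {for (x, t), continuous (fun p : R * R => rho * tau * - p.1 ^- 2)}.
    apply: cvgM; first exact: cvg_cst.
    apply: cvgN; apply: cvgV; first by rewrite expf_neq0// gt_eqF// x0.
    by apply: cvgM; exact: cvg_fst.
  apply: cvgD; apply: (ip_cvg hip).
  + by apply: cvgZ; [exact: cvg_cst|exact: j1].
  + exact: j2.
  + exact: j1.
  + by apply: cvgZ; [exact: cxx|exact: j2].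
- move=> x h; apply: continuous_ebm; apply: continuous_ip.
  + exact: (jointly_continuous_right cU (k1 x h)).
  + exact: (jointly_continuous_right cV (k2 x h)).
- move=> x /andP[/ltW tx /ltW xx1].
  have h : tau <= x <= 1 by rewrite tx.
  have gr := RI_green (k1 x h) (k2 x h).
  have -> : 0 = x^-1 * RI (fun t => r * x * ip (Ur (r * x) t) (V (rho * tau / x) t) -
     rho * tau / x * ip (U (r * x) t) (Vr (rho * tau / x) t)) by rewrite gr mulr0.
  rewrite -RI_Z; last first.
    apply: ebmB; apply: ebmZ; apply: continuous_ebm; apply: continuous_ip.
    + exact: (jointly_continuous_right cUr (k1 x h)).
    + exact: (jointly_continuous_right cV (k2 x h)).
    + exact: (jointly_continuous_right cU (k1 x h)).
    + exact: (jointly_continuous_right cVr (k2 x h)).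
  apply: eq_RI => t _; rewrite /g !(ipZl, ipZr).
  by field; rewrite gt_eqF// x0.
Qed.

End TwoFunctions.
End PolarHarmonic.

(** * The Poisson kernel in polar coordinates *)

Lemma cos_sub2pi (R : realType) (x : R) : cos (x - 2 * pi) = cos x.
Proof. by rewrite -[LHS]cosD2pi -[pi *+ 2]mulr_natl subrK. Qed.

Lemma sin_sub2pi (R : realType) (x : R) : sin (x - 2 * pi) = sin x.
Proof. by rewrite -[LHS]sinD2pi -[pi *+ 2]mulr_natl subrK. Qed.

Section PoissonPolar.
Context {R : realType} {H : completeNormedModType R}.
Variables (theta : R) (h : H).

Local Notation c t := (cos (theta - t)).
Local Notation s t := (sin (theta - t)).
Local Notation D r t := (pden r (theta - t)).
Definition poisson_r (r t : R) := (2 * c t * (1 + r ^+ 2) - 4 * r) / D r t ^+ 2.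
Definition poisson_rr (r t : R) :=
  ((4 * r * c t - 4) * D r t - 2 * (2 * c t * (1 + r ^+ 2) - 4 * r) * (2 * r - 2 * c t))
  / D r t ^+ 3.
Definition poisson_t (r t : R) := (1 - r ^+ 2) * (2 * r * s t) / D r t ^+ 2.
Definition poisson_tt (r t : R) :=
  (1 - r ^+ 2) * (2 * r) * (4 * r * s t ^+ 2 - c t * D r t) / D r t ^+ 3.

Let D_neq0 (r t : R) : 0 <= r < 1 -> D r t != 0.
Proof. by move=> r01; rewrite gt_eqF// pden_gt0. Qed.

Let dc (t : R) : is_derive t (1 : R) (fun t => c t) (s t).
Proof.
have h1 : is_derive t (1 : R) (fun t : R => theta - t) (-1).
  have := is_derive_add (is_derive_const theta t) (is_derive_opp (is_derive_var t)).
  by rewrite add0r.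
have := is_derive_chain (f := @cos R) (k := fun t => theta - t) (is_derive_cos (theta - t)) h1.
by move=> hh; apply: is_derive_eq; rewrite /GRing.scale/= mulN1r opprK.
Qed.

Let ds (t : R) : is_derive t (1 : R) (fun t => s t) (- c t).
Proof.
have h1 : is_derive t (1 : R) (fun t : R => theta - t) (-1).
  have := is_derive_add (is_derive_const theta t) (is_derive_opp (is_derive_var t)).
  by rewrite add0r.
have := is_derive_chain (f := @sin R) (k := fun t => theta - t) (is_derive_sin (theta - t)) h1.
by move=> hh; apply: is_derive_eq; rewrite /GRing.scale/= mulN1r.
Qed.

Let d2 (x : R) : is_derive x (1 : R) (fun x : R => x ^+ 2) (2 * x).
Proof.
have := is_derive_mul (is_derive_var x) (is_derive_var x).
by move=> hh; apply: is_derive_eq; rewrite mulr1 mul1r mulr2n mulrDl mul1r.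
Qed.

Let dDr (r t : R) : is_derive r (1 : R) (fun r => D r t) (2 * r - 2 * c t).
Proof.
have h1 := is_derive_mul (is_derive_mul (is_derive_const (2 : R) r) (is_derive_var r)) (is_derive_const (c t) r).
have := is_derive_add (is_derive_add (is_derive_const (1 : R) r) (is_derive_opp h1)) (d2 r).
by move=> hh; apply: is_derive_eq; ring.
Qed.

Let dDt (r t : R) : is_derive t (1 : R) (fun t => D r t) (- (2 * r * s t)).
Proof.
have h1 := is_derive_mul (is_derive_const (2 * r) t) (dc t).
have := is_derive_add (is_derive_add (is_derive_const (1 : R) t) (is_derive_opp h1)) (is_derive_const (r ^+ 2) t).
by move=> hh; apply: is_derive_eq; ring.
Qed.

Lemma is_derive_poisson_r (r t : R) : 0 <= r < 1 ->
  is_derive r (1 : R) (fun r => poisson_kernel r theta t) (poisson_r r t).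
Proof.
move=> r01; have D0 := D_neq0 t r01.
have h1 := is_derive_add (is_derive_const (1 : R) r) (is_derive_opp (d2 r)).
have := is_derive_mul h1 (is_derive_inv (f := fun r => D r t) D0 (dDr r t)).
by move=> hh; apply: is_derive_eq; move: D0; rewrite /poisson_r /pden => D0; field.
Qed.

Lemma is_derive_poisson_rr (r t : R) : 0 <= r < 1 ->
  is_derive r (1 : R) (poisson_r ^~ t) (poisson_rr r t).
Proof.
move=> r01; have D0 := D_neq0 t r01.
have D20 : D r t * D r t != 0 by rewrite mulf_neq0.
have h1 := is_derive_mul (is_derive_const (2 * c t) r) (is_derive_add (is_derive_const (1 : R) r) (d2 r)).
have h2 := is_derive_add h1 (is_derive_opp (is_derive_mul (is_derive_const (4 : R) r) (is_derive_var r))).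
have := is_derive_mul h2 (is_derive_inv (f := fun r => D r t * D r t) D20 (is_derive_mul (dDr r t) (dDr r t))).
by move=> hh; apply: is_derive_eq; rewrite /poisson_rr; field.
Qed.

Lemma is_derive_poisson_t (r t : R) : 0 <= r < 1 ->
  is_derive t (1 : R) (poisson_kernel r theta) (poisson_t r t).
Proof.
move=> r01; have D0 := D_neq0 t r01.
have := is_derive_mul (is_derive_const (1 - r ^+ 2) t) (is_derive_inv (f := fun t => D r t) D0 (dDt r t)).
by move=> hh; apply: is_derive_eq; rewrite /poisson_t; field.
Qed.

Lemma is_derive_poisson_tt (r t : R) : 0 <= r < 1 ->
  is_derive t (1 : R) (poisson_t r) (poisson_tt r t).
Proof.
move=> r01; have D0 := D_neq0 t r01.
have D20 : D r t * D r t != 0 by rewrite mulf_neq0.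
have h1 := is_derive_mul (is_derive_const (1 - r ^+ 2) t) (is_derive_mul (is_derive_const (2 * r) t) (ds t)).
have := is_derive_mul h1 (is_derive_inv (f := fun t => D r t * D r t) D20 (is_derive_mul (dDt r t) (dDt r t))).
by move=> hh; apply: is_derive_eq; rewrite /poisson_tt; field.
Qed.

Lemma poisson_laplace (r t : R) : 0 <= r < 1 ->
  poisson_tt r t = - (r ^+ 2 * poisson_rr r t + r * poisson_r r t).
Proof.
move=> r01; have D0 := D_neq0 t r01.
rewrite /poisson_tt /poisson_rr /poisson_r.
have -> : s t ^+ 2 = 1 - c t ^+ 2 by rewrite -(cos2Dsin2 (theta - t)) addrAC subrr add0r.
by move: D0; rewrite /pden => D0; field.
Qed.

Let cont_c (t r : R) : {for (r, t), continuous (fun p : R * R => c p.2)}.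
Proof.
have := is_derive_continuous (dc t).
by apply: (@cvg_comp _ _ _ snd (fun t => c t)); exact: cvg_snd.
Qed.

Let cont_r (t r : R) : {for (r, t), continuous (fun p : R * R => p.1)}.
Proof. exact: cvg_fst. Qed.

Let cont_r2 (r t : R) : {for (r, t), continuous (fun p : R * R => p.1 ^+ 2)}.
Proof.
by apply: (@cvg_comp _ _ _ fst (fun x : R => x ^+ 2)); [exact: cvg_fst|exact: exprn_continuous].
Qed.

Let cont_D (r t : R) : {for (r, t), continuous (fun p : R * R => D p.1 p.2)}.
Proof.
apply: cvgD; last exact: cont_r2.
apply: cvgB; first exact: cvg_cst.
apply: cvgM; last exact: cont_c.
by apply: cvgM; [exact: cvg_cst|exact: cont_r].
Qed.

Let cont_DV n (r t : R) : 0 <= r < 1 -> {for (r, t), continuous (fun p : R * R => (D p.1 p.2 ^+ n)^-1)}.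
Proof.
move=> r01; apply: cvgV; first by rewrite expf_neq0// D_neq0.
by apply: (cvg_comp _ (fun x : R => x ^+ n) (@cont_D r t)); exact: exprn_continuous.
Qed.

Let scale_jc (f : R -> R -> R) :
  (forall r t : R, 0 <= r < 1 -> {for (r, t), continuous (fun p : R * R => f p.1 p.2)}) ->
  jointly_continuous (fun r t => f r t *: h).
Proof. by move=> cf r t r01; apply: cvgZr_tmp; exact: cf. Qed.

Let scale_d (f : R -> R) (x df : R) : is_derive x (1 : R) f df ->
  is_derive x (1 : R) (fun x => f x *: h) (df *: h).
Proof.
move=> d; have := is_derive_scale d (is_derive_const h x).
by rewrite scaler0 addr0.
Qed.

Lemma poisson_polar_harmonic :
  polar_harmonic (fun r t => poisson_kernel r theta t *: h)
    (fun r t => poisson_r r t *: h) (fun r t => poisson_t r t *: h)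
    (fun r t => poisson_rr r t *: h) (fun r t => poisson_tt r t *: h).
Proof.
have cN (r t : R) : {for (r, t), continuous (fun p : R * R => 2 * c p.2 * (1 + p.1 ^+ 2) - 4 * p.1)}.
  apply: cvgB; last by apply: cvgM; [exact: cvg_cst|exact: cont_r].
  apply: cvgM; first by apply: cvgM; [exact: cvg_cst|exact: cont_c].
  by apply: cvgD; [exact: cvg_cst|exact: cont_r2].
split.
- apply: scale_jc => r t r01; apply: cvgM.
    by apply: cvgB; [exact: cvg_cst|exact: cont_r2].
  exact: (@cont_DV 1 r t r01).
- by apply: scale_jc => r t r01; apply: cvgM; [exact: cN|exact: cont_DV].
- apply: scale_jc => r t r01; apply: cvgM; last exact: cont_DV.
  apply: cvgB.
    apply: cvgM; last exact: cont_D.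
    apply: cvgB; last exact: cvg_cst.
    apply: cvgM; last exact: cont_c.
    by apply: cvgM; [exact: cvg_cst|exact: cont_r].
  apply: cvgM.
    by apply: cvgM; [exact: cvg_cst|exact: cN].
  by apply: cvgB; apply: cvgM; [exact: cvg_cst|exact: cont_r|exact: cvg_cst|exact: cont_c].
- by move=> r t r01; apply: scale_d; exact: is_derive_poisson_r.
- by move=> r t r01; apply: scale_d; exact: is_derive_poisson_rr.
- by move=> r t r01; apply: scale_d; exact: is_derive_poisson_t.
- by move=> r t r01; apply: scale_d; exact: is_derive_poisson_tt.
- by move=> r t r01; rewrite poisson_laplace// !scalerA -scalerDl scaleNr.
- by move=> r r01; rewrite /poisson_kernel subr0 cos_sub2pi.
- by move=> r r01; rewrite /poisson_t /pden subr0 cos_sub2pi sin_sub2pi.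
Qed.

End PoissonPolar.

(** * Harmonic maps in polar coordinates *)

Section HarmonicPolar.
Context {R : realType} {H : completeNormedModType R}.
Variable ip : {dot H for @idfun R}.
Hypothesis hip : induces_norm ip.

(** Turns an identity between vectors into one between reals, where [ring]
    applies. *)
Lemma ip_ext (x y : H) : (forall h, ip x h = ip y h) -> x = y.
Proof.
move=> xy; apply/eqP; rewrite -subr_eq0 -normr_eq0 -sqrf_eq0 -hip.
by rewrite ipBl xy subrr.
Qed.

Lemma polar_point (r t : R) : 0 <= r ->
  enorm (r * cos t, r * sin t) = r.
Proof.
move=> r0; rewrite /enorm /= !exprMn -mulrDr cos2Dsin2 mulr1 sqrtr_sqr.
by rewrite ger0_norm.
Qed.

Lemma disk_polar (r t : R) : 0 <= r < 1 -> disk (r * cos t, r * sin t).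
Proof. by move=> /andP[r0 r1]; rewrite /disk /= polar_point. Qed.

Lemma is_derive_curve (G : R * R -> H) (k l : R -> R) (x dk dl : R) :
  differentiable G (k x, l x) ->
  is_derive x (1 : R) k dk -> is_derive x (1 : R) l dl ->
  is_derive x (1 : R) (fun x => G (k x, l x))
    (dk *: 'D_ex G (k x, l x) + dl *: 'D_ey G (k x, l x)).
Proof.
move=> dG [/derivable1_diffP k1 kE] [/derivable1_diffP l1 lE].
pose g (x : R) : R * R := (k x, l x).
have dg : differentiable g x by exact: differentiable_pair.
have d : differentiable (G \o g) x by exact: differentiable_comp.
split; first exact/derivable1_diffP.
rewrite deriveE// in kE; rewrite deriveE// in lE.
rewrite -[LHS]/('D_1 (G \o g) x) (deriveE _ d) !(deriveE _ dG) diff_comp// [LHS]/=.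
rewrite diff_pair// [LHS]/= kE lE.
have -> : (dk, dl) = dk *: ex + dl *: ey :> R * R.
  by rewrite /ex /ey; congr (_, _); rewrite /= /GRing.scale/= !(mulr1, mulr0, addr0, add0r).
by rewrite linearD !linearZ.
Qed.

Variable F : R * R -> H.
Hypothesis hF : Defs.harmonic F.
Let Fx := 'D_ex F.
Let Fy := 'D_ey F.

Local Notation pt r t := (r * cos t, r * sin t).

Definition polar_map (r t : R) : H := F (pt r t).
Definition polar_map_r (r t : R) : H := cos t *: Fx (pt r t) + sin t *: Fy (pt r t).
Definition polar_map_t (r t : R) : H := - (r * sin t) *: Fx (pt r t) + (r * cos t) *: Fy (pt r t).
Definition polar_map_rr (r t : R) : H :=
  cos t *: (cos t *: 'D_ex Fx (pt r t) + sin t *: 'D_ey Fx (pt r t)) +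
  sin t *: (cos t *: 'D_ex Fy (pt r t) + sin t *: 'D_ey Fy (pt r t)).
Definition polar_map_tt (r t : R) : H :=
  (- (r * cos t) *: Fx (pt r t) +
   - (r * sin t) *: (- (r * sin t) *: 'D_ex Fx (pt r t) + (r * cos t) *: 'D_ey Fx (pt r t))) +
  (- (r * sin t) *: Fy (pt r t) +
   (r * cos t) *: (- (r * sin t) *: 'D_ex Fy (pt r t) + (r * cos t) *: 'D_ey Fy (pt r t))).

Let joint_pt (G : R * R -> H) (r t : R) : {for pt r t, continuous G} ->
  {for (r, t), continuous (fun p : R * R => G (pt p.1 p.2))}.
Proof.
move=> cG; apply: (@continuous2_cvg _ _ _ _ _ _ (fun p : R * R => p.1 * cos p.2)
  (fun p : R * R => p.1 * sin p.2) (fun x y => G (x, y)) (r * cos t) (r * sin t)).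
- by have -> : (fun z : R * R => G (z.1, z.2)) = G by apply/funext => -[].
- apply: cvgM; first exact: cvg_fst.
  by apply: (@cvg_comp _ _ _ snd cos); [exact: cvg_snd|exact: continuous_cos].
- apply: cvgM; first exact: cvg_fst.
  by apply: (@cvg_comp _ _ _ snd sin); [exact: cvg_snd|exact: continuous_sin].
Qed.

Let dpr (r t : R) : is_derive r (1 : R) (fun r => r * cos t) (cos t) /\
  is_derive r (1 : R) (fun r => r * sin t) (sin t).
Proof.
have d k : is_derive r (1 : R) (fun r => r * k) k.
  have := is_derive_mul (is_derive_var r) (is_derive_const k r).
  by move=> h; apply: is_derive_eq; rewrite mulr0 addr0 mul1r.
by split.
Qed.

Let dpt (r t : R) : is_derive t (1 : R) (fun t => r * cos t) (- (r * sin t)) /\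
  is_derive t (1 : R) (fun t => r * sin t) (r * cos t).
Proof.
split.
  have := is_derive_mul (is_derive_const r t) (is_derive_cos t).
  by move=> h; apply: is_derive_eq; rewrite mul0r add0r mulrN.
have := is_derive_mul (is_derive_const r t) (is_derive_sin t).
by move=> h; apply: is_derive_eq; rewrite mul0r add0r.
Qed.

Let curve_r (G : R * R -> H) (r t : R) : differentiable G (pt r t) ->
  is_derive r (1 : R) (fun r => G (pt r t))
    (cos t *: 'D_ex G (pt r t) + sin t *: 'D_ey G (pt r t)).
Proof.
move=> dG; have [h1 h2] := dpr r t.
exact: (@is_derive_curve G (fun r => r * cos t) (fun r => r * sin t)).
Qed.

Let curve_t (G : R * R -> H) (r t : R) : differentiable G (pt r t) ->
  is_derive t (1 : R) (fun t => G (pt r t))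
    (- (r * sin t) *: 'D_ex G (pt r t) + (r * cos t) *: 'D_ey G (pt r t)).
Proof.
move=> dG; have [h1 h2] := dpt r t.
exact: (@is_derive_curve G (fun t => r * cos t) (fun t => r * sin t)).
Qed.

(** In [r^2 U_rr + r U_r + U_tt] the mixed derivatives cancel, and [r^2] times the
    Laplacian remains. *)
Lemma harmonic_polar : polar_harmonic polar_map polar_map_r polar_map_t polar_map_rr polar_map_tt.
Proof.
have [C2 lap] := hF.
have dF z : disk z -> differentiable F z by move=> /C2[].
have dFv v z : disk z -> differentiable ('D_v F) z by move=> /C2[_ /(_ v)[]].
have cFvw v w z : disk z -> {for z, continuous ('D_w ('D_v F))}.
  by move=> /C2[_ /(_ v)[_]]; exact.
have cc (r t : R) : {for (r, t), continuous (fun p : R * R => cos p.2)}.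
  by apply: (@cvg_comp _ _ _ snd cos); [exact: cvg_snd|exact: continuous_cos].
have cs (r t : R) : {for (r, t), continuous (fun p : R * R => sin p.2)}.
  by apply: (@cvg_comp _ _ _ snd sin); [exact: cvg_snd|exact: continuous_sin].
split.
- move=> r t /(disk_polar t) z1.
  exact: (joint_pt (differentiable_continuous (dF _ z1))).
- move=> r t /(disk_polar t) z1.
  have jx := joint_pt (differentiable_continuous (dFv ex _ z1)).
  have jy := joint_pt (differentiable_continuous (dFv ey _ z1)).
  by apply: cvgD; apply: cvgZ; [exact: cc|exact: jx|exact: cs|exact: jy].
- move=> r t /(disk_polar t) z1.
  have j v w := joint_pt (cFvw v w _ z1).
  apply: cvgD; apply: cvgZ; [exact: cc| |exact: cs|].
    by apply: cvgD; apply: cvgZ; [exact: cc|exact: (j ex ex)|exact: cs|exact: (j ex ey)].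
  by apply: cvgD; apply: cvgZ; [exact: cc|exact: (j ey ex)|exact: cs|exact: (j ey ey)].
- by move=> r t /(disk_polar t) z1; apply: curve_r; exact: dF.
- move=> r t /(disk_polar t) z1.
  have h1 := is_derive_scalel (cos t) (curve_r (dFv ex _ z1)).
  have h2 := is_derive_scalel (sin t) (curve_r (dFv ey _ z1)).
  exact: (is_derive_add h1 h2).
- by move=> r t /(disk_polar t) z1; apply: curve_t; exact: dF.
- move=> r t /(disk_polar t) z1; have [d1 d2] := dpt r t.
  have h1 := is_derive_scale (is_derive_opp d2) (curve_t (dFv ex _ z1)).
  have h2 := is_derive_scale d1 (curve_t (dFv ey _ z1)).
  exact: (is_derive_add h1 h2).
- move=> r t /(disk_polar t) z1; apply: ip_ext => h.
  have lapz : 'D_ex Fx (pt r t) + 'D_ey Fy (pt r t) = 0 := lap _ z1.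
  move: lapz; rewrite /polar_map_tt /polar_map_rr /polar_map_r.
  move: ('D_ex Fx _) ('D_ey Fx _) ('D_ex Fy _) ('D_ey Fy _) (Fx _) (Fy _).
  move=> A B C D X Y /eqP; rewrite addrC addr_eq0 => /eqP ->.
  have := cos2Dsin2 t; move: (cos t) (sin t) => c s cs1.
  rewrite !(ipDl, ipNl, ipZl).
  by ring.
- by move=> r r01; rewrite /polar_map -(cos_sub2pi (2 * pi)) -(sin_sub2pi (2 * pi)) subrr.
- by move=> r r01; rewrite /polar_map_t -(cos_sub2pi (2 * pi)) -(sin_sub2pi (2 * pi)) subrr.
Qed.

End HarmonicPolar.

(** * The Poisson formula *)

Section KernelLimits.
Context {R : realType}.
Implicit Types (r theta t : R).

Lemma poisson_kernel_ge0 r theta t : 0 <= r < 1 -> 0 <= poisson_kernel r theta t.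
Proof.
move=> r01; have /andP[r0 r1] := r01.
rewrite divr_ge0//; last by rewrite ltW// pden_gt0.
by rewrite subr_ge0 expr_le1// ltW.
Qed.

Lemma poisson_kernel_le K r theta t : 0 <= r <= K -> K < 1 ->
  poisson_kernel r theta t <= (1 - K) ^- 2.
Proof.
move=> /andP[r0 rK] K1; have r1 : r < 1 := le_lt_trans rK K1.
have D0 : 0 < pden r (theta - t) by rewrite pden_gt0// r0.
have K0 : 0 < 1 - K by rewrite subr_gt0.
have h1 : (1 - K) ^+ 2 <= pden r (theta - t).
  apply: le_trans (pden_lower (theta - t) r0).
  by rewrite ler_pXn2r ?nnegrE ?subr_ge0 ?(ltW r1) ?(ltW K1)// lerB.
rewrite /poisson_kernel -/(pden r (theta - t)).
apply: (@le_trans _ _ (pden r (theta - t))^-1).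
  by rewrite ler_pdivrMr// mulVf ?gt_eqF// lerBlDr lerDl sqr_ge0.
by rewrite lef_pV2// posrE ?exprn_gt0.
Qed.

(** The denominator [(1 - r)^2 + 2 r (1 - cos)] dominates its second part. *)
Lemma poisson_kernel_tail r theta t : 0 < r < 1 ->
  poisson_kernel r theta t * (1 - cos (theta - t)) <= (1 - r ^+ 2) / (2 * r).
Proof.
move=> /andP[r0 r1]; have D0 : 0 < pden r (theta - t) by rewrite pden_gt0// ltW.
rewrite /poisson_kernel -/(pden r (theta - t)) mulrAC ler_pdivrMr//.
rewrite -[leRHS]mulrA ler_wpM2l ?subr_ge0 ?expr_le1 ?(ltW r0) ?(ltW r1)//.
rewrite mulrC ler_pdivlMr ?mulr_gt0//.
rewrite -subr_ge0 /pden.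
have -> : 1 - 2 * r * cos (theta - t) + r ^+ 2 - (1 - cos (theta - t)) * (2 * r) = (1 - r) ^+ 2 by ring.
exact: sqr_ge0.
Qed.

Lemma RI_kernel_cvg (tau : nat -> R) tau1 K theta (u : R -> R) :
  (forall n, 0 <= tau n <= K) -> 0 <= tau1 <= K -> K < 1 -> continuous u ->
  tau n @[n --> \oo] --> tau1 ->
  RI (fun t => poisson_kernel (tau n) theta t * u t) @[n --> \oo] -->
  RI (fun t => poisson_kernel tau1 theta t * u t).
Proof.
move=> tK t1K K1 cu ct.
have lt1 r : 0 <= r <= K -> 0 <= r < 1.
  by move=> /andP[-> rK]; rewrite (le_lt_trans rK).
have [M uM] := continuous_bounded_angles cu.
have cp r : 0 <= r <= K -> continuous (fun t => poisson_kernel r theta t * u t).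
  move=> rK t; apply: cvgM; last exact: cu.
  exact: (@continuous_poisson_kernel R r theta (lt1 r rK) t).
apply: (@RI_cvg _ _ _ ((1 - K) ^- 2 * M)).
- by move=> n; have [] := continuous_ebm (cp _ (tK n)).
- by apply: continuous_ebm; exact: cp.
- move=> n t at_; rewrite normrM ler_pM ?uM//.
  by rewrite ger0_norm ?poisson_kernel_le// poisson_kernel_ge0// lt1.
- apply: aeW => t _; apply: cvgM; last exact: cvg_cst.
  have t1 := lt1 _ t1K.
  have cX : tau n ^+ 2 @[n --> \oo] --> tau1 ^+ 2.
    by apply: (cvg_comp _ (fun x => x ^+ 2) ct); exact: exprn_continuous.
  apply: cvgM; first by apply: cvgB; [exact: cvg_cst|exact: cX].
  apply: cvgV; first by rewrite gt_eqF// pden_gt0.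
  apply: cvgD; last exact: cX.
  apply: cvgB; first exact: cvg_cst.
  apply: cvgM; last exact: cvg_cst.
  by apply: cvgM; [exact: cvg_cst|exact: ct].
Qed.

Definition to_one (n : nat) : R := 1 - n.+2%:R^-1.

Lemma to_one_itv n : 0 < to_one n < 1.
Proof.
rewrite /to_one subr_gt0 invf_lt1 ?ltr0n// ltr1n/=.
by rewrite ltrBlDr ltrDl invr_gt0 ltr0n.
Qed.

Lemma inv_to0 : (n.+2%:R^-1 : R) @[n --> \oo] --> (0 : R).
Proof.
have := @cvg_harmonic R; rewrite -(cvg_shiftS _).
by apply: cvg_trans.
Qed.

Lemma to_one_cvg : to_one n @[n --> \oo] --> (1 : R).
Proof.
rewrite -[X in _ --> X]subr0; apply: cvgB; first exact: cvg_cst.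
exact: inv_to0.
Qed.

End KernelLimits.

Section PoissonFormula.
Context {R : realType} {H : completeNormedModType R}.
Variable ip : {dot H for @idfun R}.
Hypothesis hip : induces_norm ip.

Lemma const_polar_harmonic (h : H) :
  polar_harmonic (fun _ _ => h) (fun _ _ : R => 0) (fun _ _ : R => 0)
   (fun _ _ : R => 0) (fun _ _ : R => 0).
Proof.
have cc (k : H) : jointly_continuous (fun _ _ : R => k) by move=> r t _; exact: cvg_cst.
split=> //; try (by move=> r t _; exact: is_derive_const).
by move=> r t _; rewrite !scaler0 addr0 oppr0.
Qed.

(** Pairing the kernel with a constant map, [RI_scale] shows that the integral
    does not depend on [r]; at [r = 0] the kernel is 1.  The nonzero vector [h]
    serves to read scalars off the Hilbert space. *)
Lemma RI_kernel (h : H) (r theta : R) : h != 0 -> 0 <= r < 1 ->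
  RI (poisson_kernel r theta) = 2 * pi.
Proof.
move=> h0 r01; have /andP[r0 r1] := r01.
have hh : ip h h != 0 by rewrite hip sqrf_eq0 normr_eq0.
have Bsc (x : R) : 0 < x < 1 -> RI (poisson_kernel r theta) = RI (poisson_kernel (r * x) theta).
  move=> x01.
  have := RI_scale hip (const_polar_harmonic h) (poisson_polar_harmonic theta h)
    r01 r01 x01.
  have e y : 0 <= y < 1 -> RI (fun t => ip h (poisson_kernel y theta t *: h)) =
      ip h h * RI (poisson_kernel y theta).
    move=> y01; rewrite -RI_Z; last by apply: continuous_ebm; exact: continuous_poisson_kernel.
    by apply: eq_RI => t _; rewrite ipZr mulrC.
  have x1 : 0 <= r * x < 1.
    have /andP[x0 x1] := x01; rewrite mulr_ge0 ?(ltW x0)//=.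
    by rewrite (le_lt_trans _ r1)// ler_piMr// ltW.
  by rewrite !e// => /(mulfI hh).
have c1 : RI (fun t => poisson_kernel (r * n.+2%:R^-1) theta t * 1) @[n --> \oo] -->
    RI (fun t => poisson_kernel 0 theta t * 1).
  apply: (@RI_kernel_cvg _ _ _ r) => //.
  - by move=> n; rewrite mulr_ge0//= ler_piMr// invf_le1 ?ltr0n// ler1n.
  - by rewrite lexx.
  - exact: cst_continuous.
  - by rewrite -[X in _ --> X](mulr0 r); apply: cvgM; [exact: cvg_cst|exact: inv_to0].
have e1 : RI (fun t => poisson_kernel 0 theta t * 1) = 2 * pi.
  by rewrite -[RHS]mulr1 -RI_cst; apply: eq_RI => t _; rewrite poisson_kernel0 mulr1.
have c2 : RI (fun t => poisson_kernel (r * n.+2%:R^-1) theta t * 1) @[n --> \oo] -->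
    RI (poisson_kernel r theta).
  have -> : (fun n => RI (fun t => poisson_kernel (r * n.+2%:R^-1) theta t * 1)) =
      fun=> RI (poisson_kernel r theta); last exact: cvg_cst.
  apply/funext => n; rewrite (Bsc n.+2%:R^-1).
    by apply: eq_RI => t _; rewrite mulr1.
  by rewrite invr_gt0 ltr0n invf_lt1 ?ltr0n ?ltr1n.
by rewrite -e1; exact: (cvg_unique _ c2 c1).
Qed.

Variable F : R * R -> H.
Hypothesis hF : Defs.harmonic F.
Local Notation pt r t := (r * cos t, r * sin t).

Lemma harmonic_continuous z : disk z -> {for z, continuous F}.
Proof. by move=> /(proj1 hF)[dF _]; exact: differentiable_continuous. Qed.

Lemma circle_continuous (rho : R) : 0 <= rho < 1 -> continuous (fun t => F (pt rho t)).
Proof.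
by move=> r01; exact: (jointly_continuous_right (ph_cont (harmonic_polar hip hF)) r01).
Qed.

Lemma circle_ip_continuous (rho : R) h : 0 <= rho < 1 ->
  continuous (fun t => ip (F (pt rho t)) h).
Proof.
move=> r01; apply: (continuous_ip hip) => //; first exact: circle_continuous.
exact: cst_continuous.
Qed.

(** Near [theta] this is continuity; elsewhere the chord satisfies
    [|e^(i theta) - e^(it)|^2 = 2 (1 - cos (theta - t))] and is bounded below, so
    that boundedness suffices. *)
Lemma circle_modulus (rho theta : R) (h : H) (e : R) : 0 <= rho < 1 -> 0 < e ->
  exists2 C : R, 0 <= C & forall t, angles t ->
  `|ip (F (pt rho t)) h - ip (F (pt rho theta)) h| <= e + C * (1 - cos (theta - t)).
Proof.
move=> r01 e0; set u := fun t => ip (F (pt rho t)) h.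
have [M uM] := continuous_bounded_angles (circle_ip_continuous (h := h) r01).
have cF := harmonic_continuous (disk_polar theta r01).
have cu : {for pt rho theta, continuous (fun z => ip (F z) h)}.
  by apply: (ip_continuous_at hip) => //; exact: cvg_cst.
have /cvgrPdist_le /(_ e e0) := cu.
move=> /nbhs_ballP[d /= d0 hd].
pose M' := M + `|u theta|.
have M'0 : 0 <= M'.
  have a0 : angles (0 : R) by rewrite /Defs.angles /= in_itv/= lexx mulr_ge0 ?pi_ge0.
  by rewrite addr_ge0// (le_trans (normr_ge0 _) (uM 0 a0)).
have C0 : 0 <= M' * 2 / d ^+ 2.
  by rewrite mulr_ge0 ?invr_ge0 ?exprn_ge0 ?(ltW d0)// mulr_ge0.
(* Away from theta, 2 (1 - cos) >= d^2. *)
exists (M' * 2 / d ^+ 2) => [//|t at_].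
have k0 : 0 <= 1 - cos (theta - t) by rewrite subr_ge0 cos_le1.
have [near_|far] := pselect (ball (pt rho theta) d (pt rho t)).
  by rewrite distrC (le_trans (hd _ near_))// lerDl mulr_ge0.
apply: (@le_trans _ _ M').
  by rewrite (le_trans (ler_normB _ _))// lerD2r uM.
rewrite (le_trans _ (_ : M' * 2 / d ^+ 2 * (1 - cos (theta - t)) <= _)) ?lerDr ?(ltW e0)//.
have d20 : 0 < d ^+ 2 by rewrite exprn_gt0.
rewrite mulrAC ler_pdivlMr// -mulrA ler_wpM2l//.
have sqE : 2 * (1 - cos (theta - t)) =
    (cos theta - cos t) ^+ 2 + (sin theta - sin t) ^+ 2.
  transitivity ((cos theta ^+ 2 + sin theta ^+ 2) + (cos t ^+ 2 + sin t ^+ 2) -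
    2 * (cos theta * cos t + sin theta * sin t)); last by ring.
  by rewrite !cos2Dsin2 cosB; ring.
have rho1 : rho ^+ 2 <= 1 by case/andP: r01 => ? /ltW ?; rewrite expr_le1.
have sq (x : R) : d <= `|rho * x| -> d ^+ 2 <= x ^+ 2.
  move=> dx; apply: (@le_trans _ _ ((rho * x) ^+ 2)).
    by rewrite -(real_normK (num_real (rho * x))) ler_pXn2r ?nnegrE ?(ltW d0).
  by rewrite exprMn ler_piMl ?sqr_ge0.
rewrite sqE; have [c1|c1] := ltP `|rho * (cos theta - cos t)| d.
  have [s1|s1] := ltP `|rho * (sin theta - sin t)| d.
    by case: far; split; rewrite /ball /= -mulrBr.
  by rewrite (le_trans (sq _ s1))// lerDr sqr_ge0.
by rewrite (le_trans (sq _ c1))// lerDl sqr_ge0.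
Qed.

(** The kernel is a nonnegative approximate identity.  In the bound of
    [circle_modulus] the first term contributes at most [e / 2], and by
    [poisson_kernel_tail] the second one contributes [O(1 - r)]. *)
Lemma RI_kernel_to_one (rho theta : R) (h : H) : 0 <= rho < 1 ->
  RI (fun t => poisson_kernel (to_one n) theta t * ip (F (pt rho t)) h) @[n --> \oo] -->
  2 * pi * ip (F (pt rho theta)) h.
Proof.
have [->|h0] := eqVneq h 0.
  move=> _; rewrite ip0r mulr0.
  under eq_fun do under [X in RI X]eq_fun do rewrite ip0r mulr0.
  by rewrite RI_cst mulr0; exact: cvg_cst.
move=> r01; set u := fun t => ip (F (pt rho t)) h.
rewrite -[X in 2 * pi * X]/(u theta).
apply/cvgrPdist_le => e e0.
have p0 : 0 < 2 * pi :> R by rewrite mulr_gt0 ?pi_gt0.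
have e1 : 0 < e / 2 / (2 * pi) by rewrite !divr_gt0.
have [C C0 hC] := circle_modulus theta h r01 e1.
have ceu : continuous (fun t => u t - u theta).
  by move=> t; apply: cvgB; [exact: circle_ip_continuous|exact: cvg_cst].
have small : 2 * pi * (C * ((1 - to_one n ^+ 2) / (2 * to_one n))) @[n --> \oo] --> (0 : R).
  have -> : (0 : R) = 2 * pi * (C * ((1 - 1 ^+ 2) / (2 * 1))).
    by rewrite expr1n subrr mul0r !mulr0.
  apply: cvgM; first exact: cvg_cst.
  apply: cvgM; first exact: cvg_cst.
  apply: cvgM.
    apply: cvgB; first exact: cvg_cst.
    by apply: (cvg_comp _ (fun x => x ^+ 2) to_one_cvg); exact: exprn_continuous.
  apply: cvgV; first by rewrite mulr1.
  by apply: cvgM; [exact: cvg_cst|exact: to_one_cvg].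
have e2 : 0 < e / 2 by rewrite divr_gt0.
move/cvgrPdist_le: small => /(_ _ e2) small.
near=> n.
have t01 := @to_one_itv R n; have /andP[t0 t1] := t01.
have t01' : 0 <= (to_one n : R) < 1 by rewrite (ltW t0).
have ck := continuous_ebm (@continuous_poisson_kernel R (to_one n) theta t01').
have eu : ebm u := continuous_ebm (circle_ip_continuous (h := h) r01).
rewrite distrC.
have -> : RI (fun t => poisson_kernel (to_one n) theta t * u t) - 2 * pi * u theta =
    RI (fun t => poisson_kernel (to_one n) theta t * (u t - u theta)).
  rewrite -(RI_kernel theta h0 t01') mulrC -RI_Z// -RI_B; [|exact: ebmM|exact: ebmZ].
  by apply: eq_RI => t _; rewrite mulrBr [u theta * _]mulrC.
have ed : ebm (fun t => poisson_kernel (to_one n) theta t * (u t - u theta)).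
  by apply: ebmM => //; exact: continuous_ebm.
rewrite (le_trans (RI_norm ed))//.
have ekc : ebm (fun t => poisson_kernel (to_one n) theta t * (e / 2 / (2 * pi)) +
    C * ((1 - to_one n ^+ 2) / (2 * to_one n))).
  by apply: ebmD; [apply: ebmM => //|]; exact: ebm_cst.
apply: (@le_trans _ _ (RI (fun t => poisson_kernel (to_one n) theta t * (e / 2 / (2 * pi)) +
    C * ((1 - to_one n ^+ 2) / (2 * to_one n))))).
  apply: RI_le => //; first exact: ebm_norm.
  move=> t at_; have k0 := poisson_kernel_ge0 theta t t01'.
  rewrite normrM ger0_norm// (le_trans (ler_wpM2l k0 (hC t at_)))//.
  rewrite mulrDr lerD2l mulrCA ler_wpM2l//.
  exact: poisson_kernel_tail.
rewrite RI_D; [|by apply: ebmM => //; exact: ebm_cst|exact: ebm_cst].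
rewrite RI_cst.
have -> : RI (fun t => poisson_kernel (to_one n) theta t * (e / 2 / (2 * pi))) = e / 2.
  under eq_fun do rewrite mulrC.
  by rewrite RI_Z// (RI_kernel theta h0 t01') divfK// gt_eqF.
rewrite [leRHS](splitr e) lerD2l.
have : `|0 - 2 * pi * (C * ((1 - to_one n ^+ 2) / (2 * to_one n)))| <= e / 2 by near: n.
by rewrite sub0r normrN => /(le_trans (ler_norm _)).
Unshelve. all: by end_near. Qed.

(** By [RI_scale], the kernel at [x tau_n] against the circle of radius [rho] is the
    kernel at [tau_n] against the circle of radius [rho x].  As [tau_n] tends to 1,
    the first tends to the Poisson integral, and the second to the value of [F]. *)
Lemma poisson_formula (rho tau theta : R) (h : H) : 0 <= rho < 1 -> 0 <= tau < 1 ->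
  RI (fun t => poisson_kernel tau theta t * ip (F (pt rho t)) h) =
  2 * pi * ip (F (pt (rho * tau) theta)) h.
Proof.
move=> r01 t01; have /andP[r0 r1] := r01.
set u := fun r t => ip (F (pt r t)) h.
have mul01 (x y : R) : 0 <= x < 1 -> 0 <= y <= 1 -> 0 <= x * y < 1.
  move=> /andP[x0 x1] /andP[y0 y1]; rewrite mulr_ge0//=.
  by rewrite (le_lt_trans _ x1)// ler_piMr.
have sc (x y : R) : 0 <= y < 1 -> 0 < x < 1 ->
    RI (fun t => poisson_kernel y theta t * u (rho * x) t) =
    RI (fun t => poisson_kernel (y * x) theta t * u rho t).
  move=> y01 x01.
  have := RI_scale hip (harmonic_polar hip hF) (poisson_polar_harmonic theta h) r01 y01 x01.
  have e (a b : R) : RI (fun t => ip (polar_map F a t) (poisson_kernel b theta t *: h)) =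
      RI (fun t => poisson_kernel b theta t * u a t).
    by apply: eq_RI => t _; rewrite ipZr.
  by rewrite !e.
(* RI_scale concerns a positive ratio of radii: tau = 0 is reached as a limit. *)
have pos (x : R) : 0 < x < 1 ->
    RI (fun t => poisson_kernel x theta t * u rho t) = 2 * pi * u (rho * x) theta.
  move=> x01; have /andP[x0 x1] := x01.
  have x01' : 0 <= x <= 1 by rewrite !ltW.
  have c1 := RI_kernel_to_one (theta := theta) (h := h) (mul01 _ _ r01 x01').
  have c2 : RI (fun t => poisson_kernel (to_one n * x) theta t * u rho t) @[n --> \oo] -->
      RI (fun t => poisson_kernel x theta t * u rho t).
    apply: (@RI_kernel_cvg _ _ _ x) => //.
    - move=> n; have /andP[t0 /ltW t1] := @to_one_itv R n.
      by rewrite mulr_ge0 ?(ltW t0) ?(ltW x0)//= ler_piMl// ltW.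
    - by rewrite lexx ltW.
    - exact: circle_ip_continuous.
    - rewrite -[X in _ --> X]mul1r; apply: cvgM; last exact: cvg_cst.
      exact: to_one_cvg.
  have E : (fun n => RI (fun t => poisson_kernel (to_one n * x) theta t * u rho t)) =
     (fun n => RI (fun t => poisson_kernel (to_one n) theta t * ip (F (pt (rho * x) t)) h)).
    apply/funext => n; rewrite -sc//; have /andP[/ltW t0 t1] := @to_one_itv R n.
    by rewrite t0.
  by rewrite E in c2; exact: (cvg_unique _ c2 c1).
have [tau0|tau0] := eqVneq tau 0; last first.
  by apply: pos; have /andP[t0 ->] := t01; rewrite lt_neqAle eq_sym tau0 t0.
rewrite tau0 mulr0.
have i2 n : 0 <= (n.+2%:R^-1 : R) <= 2^-1.
  by rewrite invr_ge0 ler0n/= lef_pV2 ?posrE ?ltr0n// ler_nat.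
have c1 : RI (fun t => poisson_kernel (n.+2%:R^-1) theta t * u rho t) @[n --> \oo] -->
    RI (fun t => poisson_kernel 0 theta t * u rho t).
  apply: (@RI_kernel_cvg _ _ _ (2^-1)) => //.
  - by rewrite lexx invr_ge0 ler0n.
  - by rewrite invf_lt1 ?ltr0n// ltr1n.
  - exact: circle_ip_continuous.
  - exact: inv_to0.
have E : (fun n => RI (fun t => poisson_kernel (n.+2%:R^-1) theta t * u rho t)) =
    (fun n => 2 * pi * u (rho * n.+2%:R^-1) theta).
  apply/funext => n; apply: pos.
  by rewrite invr_gt0 ltr0n/= invf_lt1 ?ltr0n// ltr1n.
rewrite E in c1.
suff c2 : 2 * pi * u (rho * n.+2%:R^-1) theta @[n --> \oo] -->
    2 * pi * ip (F (pt 0 theta)) h by exact: (cvg_unique _ c1 c2).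
apply: cvgM; first exact: cvg_cst.
have cz : {for pt 0 theta, continuous (fun z => ip (F z) h)}.
  apply: (ip_continuous_at hip); last exact: cvg_cst.
  by apply: harmonic_continuous; apply: disk_polar; rewrite lexx ltr01.
have c0 : (rho * n.+2%:R^-1) @[n --> \oo] --> (0 : R).
  by rewrite -[X in _ --> X](mulr0 rho); apply: cvgM; [exact: cvg_cst|exact: inv_to0].
apply: (@continuous2_cvg _ _ _ _ _ _ (fun n => rho * n.+2%:R^-1 * cos theta)
  (fun n => rho * n.+2%:R^-1 * sin theta) (fun x y => ip (F (x, y)) h)
  (0 * cos theta) (0 * sin theta)).
- by have <- : (fun z : R * R => ip (F z) h) = (fun z => ip (F (z.1, z.2)) h) by apply/funext => -[].
- by apply: cvgM; [exact: c0|exact: cvg_cst].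
- by apply: cvgM; [exact: c0|exact: cvg_cst].
Qed.

End PoissonFormula.

(** * Uniform approximation by simple maps *)

Section SimpleApproximation.
Context {R : realType} {H : completeNormedModType R}.
Local Notation mu := (@lebesgue_measure R).
Local Notation angles := (@angles R).
Local Notation simple := (bochner_simple mu angles : (R -> H) -> Prop).

Lemma simple_if (A : set R) (y : H) (g : R -> H) : measurable A -> simple g ->
  simple (fun t => if t \in A then y else g t).
Proof.
move=> mA [fg mg _]; apply: bochner_simple_intro.
  apply: (sub_finite_set (B := y |` range g)).
    by move=> _ [t _ <-]; case: ifP => _; [left|right; exists t].
  by rewrite finite_setU; split.
move=> z; have [<-|zy] := eqVneq y z.
  rewrite (_ : _ @^-1` _ = A `|` g @^-1` [set y]); first by apply: measurableU; [exact: mA|exact: mg].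
  apply/seteqP; split => t /=; have [tA|tA] := pselect (A t).
  - by move=> _; left.
  - by rewrite (memNset tA); right.
  - by rewrite (mem_set tA).
  - by rewrite (memNset tA) => -[].
rewrite (_ : _ @^-1` _ = ~` A `&` g @^-1` [set z]).
  by apply: measurableI; [exact: measurableC|exact: mg].
apply/seteqP; split => t /=; have [tA|tA] := pselect (A t).
- by rewrite (mem_set tA) => yz; rewrite yz eqxx in zy.
- by rewrite (memNset tA).
- by move=> [].
- by rewrite (memNset tA) => -[].
Qed.

Lemma simple_cst (y : H) : simple (fun=> y).
Proof.
apply: bochner_simple_intro.
  by apply: (sub_finite_set (B := [set y])) => // _ [t _ <-].
move=> z; have [->|yz] := eqVneq y z.
  by rewrite (_ : _ @^-1` _ = setT) //; apply/seteqP; split.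
rewrite (_ : _ @^-1` _ = set0) //; apply/seteqP; split => // t /= yz'.
by rewrite yz' eqxx in yz.
Qed.

(** Cover the compact image of a period by finitely many balls, and send [t] to the
    first centre that is close to [f t]. *)
Lemma simple_approximation (f : R -> H) (e : R) : continuous f -> 0 < e ->
  exists2 g, simple g & forall t, angles t -> `|f t - g t| < e.
Proof.
move=> cf e0.
have : compact (f @` angles).
  apply: continuous_compact; first exact: continuous_subspaceT.
  exact: segment_compact.
rewrite compact_cover => /(_ H setT (fun y => ball y e)) [].
- by move=> y _; exact: ball_open.
- by move=> _ [t _ <-]; exists (f t) => //; exact: ballxx.
move=> ys _ cov.
pose g t := foldr (fun y z => if t \in f @^-1` ball y e then y else z) 0 (finmap.enum_fset ys).
have gE s t : has (fun y => t \in f @^-1` ball y e) s ->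
    `|f t - foldr (fun y z => if t \in f @^-1` ball y e then y else z) 0 s| < e.
  elim: s => //= y s ih; case: ifPn => [|_ /= /ih]//.
  by move=> + _ => /set_mem; rewrite /= -ball_normE /= distrC.
exists g; last first.
  move=> t at_; apply: gE; have [|y yin yb] := cov (f t); first by exists t.
  by apply/hasP; exists y => //; rewrite inE.
rewrite /g; elim: (finmap.enum_fset ys) => [|y s ih] /=; first exact: simple_cst.
apply: simple_if => //; apply: open_measurable.
by apply: open_comp => [t _|]; [exact: cf|exact: ball_open].
Qed.

End SimpleApproximation.

(** * Mean square convergence of the circles *)

Section ConvexSequence.
Context {R : realType}.

(** If the first increment were positive, convexity would make the sequence grow at
    least linearly. *)
Lemma convex_bounded_decrease (a : nat -> R) C :
  (forall k, 2 * a k.+1 <= a k + a k.+2) -> (forall k, a k <= C) -> a 1%N <= a 0%N.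
Proof.
move=> cvx aC; rewrite leNgt; apply/negP => a01.
have d0 : 0 < a 1%N - a 0%N by rewrite subr_gt0.
have inc k : a 1%N - a 0%N <= a k.+1 - a k.
  by elim: k => // k ih; apply: (le_trans ih); have := cvx k; lra.
have lin k : a 0%N + k%:R * (a 1%N - a 0%N) <= a k.
  elim: k => [|k ih]; first by rewrite mul0r addr0.
  by have := inc k; rewrite -natr1 mulrDl mul1r; lra.
have := archi_boundP (x := `|(C - a 0%N) / (a 1%N - a 0%N)|) (normr_ge0 _).
set m := Num.bound _ => hm.
have : (C - a 0%N) / (a 1%N - a 0%N) < m%:R by apply: le_lt_trans hm; rewrite ler_norm.
rewrite ltr_pdivrMr// => h; have := lin m; have := aC m; lra.
Qed.

End ConvexSequence.

Section Energy.
Context {R : realType} {H : completeNormedModType R}.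
Variable ip : {dot H for @idfun R}.
Hypothesis hip : induces_norm ip.
Variables (F : R * R -> H) (M : R).
Hypothesis hF : Defs.harmonic F.
Hypothesis hM : forall z, disk z -> `|F z| <= M.

Local Notation pt r t := (r * cos t, r * sin t).

Definition energy (r : R) := RI (fun t => `|F (pt r t)| ^+ 2).

Let cF (r : R) : 0 <= r < 1 -> continuous (fun t => F (pt r t)).
Proof. exact: (circle_continuous hip hF). Qed.

Let cip (r rho : R) : 0 <= r < 1 -> 0 <= rho < 1 ->
  ebm (fun t => ip (F (pt r t)) (F (pt rho t))).
Proof.
by move=> r01 rho01; apply: continuous_ebm; apply: (continuous_ip hip); exact: cF.
Qed.

Let energyE r : energy r = RI (fun t => ip (F (pt r t)) (F (pt r t))).
Proof. by apply: eq_RI => t _; rewrite hip. Qed.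

Lemma energy_le (r : R) : 0 <= r < 1 -> energy r <= 2 * pi * M ^+ 2.
Proof.
move=> r01; rewrite energyE -RI_cst; apply: RI_le; [exact: cip|exact: ebm_cst|].
move=> t _; have h := hM (disk_polar t r01).
by rewrite hip ler_pXn2r ?nnegrE ?(le_trans (normr_ge0 _) h).
Qed.

Let shrink (x s : R) : 0 <= x < 1 -> 0 < s < 1 -> 0 <= x * s < 1.
Proof.
move=> /andP[x0 x1] /andP[s0 s1]; rewrite mulr_ge0 ?(ltW s0)//=.
by rewrite (le_lt_trans _ x1)// ler_piMr// ltW.
Qed.

(** Expand the square; by [RI_scale] the cross term at radii [x s s] and [x] is the
    energy at their geometric mean [x s]. *)
Lemma energy_distance (x s : R) : 0 <= x < 1 -> 0 < s < 1 ->
  RI (fun t => `|F (pt x t) - F (pt (x * s * s) t)| ^+ 2) =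
  energy x + energy (x * s * s) - 2 * energy (x * s).
Proof.
move=> x01 s01; have xs := shrink x01 s01; have xss := shrink xs s01.
have q : RI (fun t => ip (F (pt (x * s * s) t)) (F (pt x t))) = energy (x * s).
  by rewrite energyE; exact: (RI_scale hip (harmonic_polar hip hF) (harmonic_polar hip hF)).
rewrite -q !energyE -RI_Z; last exact: cip.
rewrite -RI_D; [|exact: cip..]. rewrite -RI_B; [|by apply: ebmD; exact: cip|by apply: ebmZ; exact: cip].
apply: eq_RI => t _.
by rewrite -hip ipBl !ipBr (ipC ip (F (pt x t)) (F (pt (x * s * s) t))); ring.
Qed.

(** The energies at [x s^k] form a convex bounded sequence, by
    [energy_distance]. *)
Lemma energy_shrink (x s : R) : 0 <= x < 1 -> 0 < s < 1 -> energy (x * s) <= energy x.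
Proof.
move=> x01 s01.
have xk k : 0 <= x * s ^+ k < 1.
  by elim: k => [|k ih]; rewrite ?expr0 ?mulr1// exprSr mulrA shrink.
have := @convex_bounded_decrease _ (fun k => energy (x * s ^+ k)) (2 * pi * M ^+ 2).
rewrite /= expr0 mulr1 expr1; apply => k; last exact: energy_le.
have : 0 <= RI (fun t => `|F (pt (x * s ^+ k) t) - F (pt (x * s ^+ k * s * s) t)| ^+ 2).
  by apply: RI_ge0 => t _; exact: sqr_ge0.
by rewrite energy_distance// !exprSr !mulrA subr_ge0.
Qed.

Lemma energy_mono (r rho : R) : 0 < r <= rho -> rho < 1 -> energy r <= energy rho.
Proof.
move=> /andP[r0 rr] rho1; have [->//|ne] := eqVneq r rho.
have lt : r < rho by rewrite lt_neqAle ne.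
have rho0 : 0 < rho := lt_trans r0 lt.
have -> : r = rho * (r / rho) by rewrite mulrCA divff ?mulr1// gt_eqF.
apply: energy_shrink; first by rewrite ltW.
by rewrite divr_gt0//= ltr_pdivrMr// mul1r.
Qed.

(** Apply [energy_distance] with [s^2 = r / rho] and use that the energy at the
    geometric mean is at least the one at [r]. *)
Lemma energy_distance_le (r rho : R) : 0 < r < rho -> rho < 1 ->
  RI (fun t => `|F (pt rho t) - F (pt r t)| ^+ 2) <= energy rho - energy r.
Proof.
move=> /andP[r0 rr] rho1; have rho0 : 0 < rho := lt_trans r0 rr.
pose s := Num.sqrt (r / rho).
have q0 : 0 < r / rho by rewrite divr_gt0.
have s2 : s * s = r / rho by rewrite -expr2 sqr_sqrtr// ltW.
have s01 : 0 < s < 1.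
  rewrite sqrtr_gt0 q0/= -sqrtr1 ltr_sqrt//.
  by rewrite ltr_pdivrMr// mul1r.
have rho01 : 0 <= rho < 1 by rewrite ltW.
have rE : r = rho * s * s by rewrite -mulrA s2 mulrCA divff ?mulr1// gt_eqF.
rewrite rE energy_distance//.
have := energy_shrink (shrink rho01 s01) s01; lra.
Qed.

(** Choose [rs k] with energy within [4^-k] of the supremum.  The distance between
    two circles is controlled by the smaller energy, so the radii need not
    increase. *)
Lemma fast_radii : exists rs : nat -> R, forall k,
  [/\ 0 < rs k < 1, to_one k <= rs k &
   RI (fun t => `|F (pt (rs k.+1) t) - F (pt (rs k) t)| ^+ 2) <= 4^-1 ^+ k].
Proof.
pose A := [set energy r | r in [set r : R | 0 < r < 1]].
have hA : has_sup A.
  split; first by exists (energy 2^-1), 2^-1 => //=; rewrite invr_gt0 ltr0n invf_lt1 ?ltr1n.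
  by exists (2 * pi * M ^+ 2) => _ [r /andP[r0 r1] <-]; apply: energy_le; rewrite ltW.
have step k : exists r : R, [/\ 0 < r < 1, to_one k <= r & sup A - 4^-1 ^+ k < energy r].
  have e0 : 0 < (4^-1 ^+ k : R) by rewrite exprn_gt0.
  have [_ [r /andP[r0 r1] <-] hr] := sup_adherent e0 hA.
  have /andP[t0 t1] := @to_one_itv R k.
  exists (Num.max r (to_one k)); split.
  - by rewrite lt_max r0 gt_max r1.
  - by rewrite le_max lexx orbT.
  - apply: (lt_le_trans hr); apply: energy_mono; last by rewrite gt_max r1.
    by rewrite r0 le_max lexx.
have [rs hrs] := choice step; exists rs => k.
have [k01 kt ke] := hrs k; have [k01' _ ke'] := hrs k.+1.
split => //.
have Ale r : 0 < r < 1 -> energy r <= sup A by move=> r01; apply: sup_upper_bound => //; exists r.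
have [/andP[k0 k1] /andP[k0' k1']] := (k01, k01').
have p4 : (4^-1 ^+ k.+1 : R) <= 4^-1 ^+ k.
  by rewrite exprS ler_piMl ?exprn_ge0// invf_le1 ?ler1n.
case: (ltgtP (rs k) (rs k.+1)) => [lt|lt|->].
- apply: (le_trans (energy_distance_le _ _)) => //; first by rewrite k0.
  by have := Ale _ k01'; lra.
- under eq_RI => t _ do rewrite distrC.
  apply: (le_trans (energy_distance_le _ _)) => //; first by rewrite k0'.
  by have := Ale _ k01; lra.
- rewrite (_ : RI _ = 0) ?exprn_ge0//.
  rewrite -[RHS](mulr0 (2 * pi)) -RI_cst; apply: eq_RI => t _.
  by rewrite subrr normr0 expr0n.
Qed.

End Energy.

(** * Boundary values of bounded harmonic maps *)

Section Fatou.
Context {R : realType} {H : completeNormedModType R}.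
Variable ip : {dot H for @idfun R}.
Hypothesis hip : induces_norm ip.
Variables (F : R * R -> H) (M : R).
Hypothesis hF : Defs.harmonic F.
Hypothesis hM : forall z, disk z -> `|F z| <= M.
Variable rs : nat -> R.
Hypothesis hrs : forall k, 0 < rs k < 1.
Hypothesis rs_to_one : forall k, to_one k <= rs k.
Local Notation pt r t := (r * cos t, r * sin t).
Hypothesis rs_fast : forall k,
  RI (fun t => `|F (pt (rs k.+1) t) - F (pt (rs k) t)| ^+ 2) <= 4^-1 ^+ k.
Local Notation mu := (@lebesgue_measure R).
Local Notation angles := (@angles R).
Local Notation simple := (bochner_simple mu angles : (R -> H) -> Prop).

Let circ k t := F (pt (rs k) t).
Let incr k t : R := `|circ k.+1 t - circ k t|.

Let rs01 k : 0 <= rs k < 1.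
Proof. by have /andP[h ->] := hrs k; rewrite ltW. Qed.

Let circ_cont k : continuous (circ k).
Proof. exact: (circle_continuous hip hF (rs01 k)). Qed.

Let incr_cont k : continuous (incr k).
Proof. by move=> t; apply: cvg_norm; apply: cvgB; exact: circ_cont. Qed.

Let circ_le k t : `|circ k t| <= M.
Proof. by apply: hM; exact: disk_polar. Qed.

Let rs_cvg : rs k @[k --> \oo] --> (1 : R).
Proof.
have h : \forall k \near \oo, to_one k <= rs k <= 1.
  by apply: nearW => k; rewrite rs_to_one; have /andP[_ /ltW] := hrs k.
by apply: (squeeze_cvgr h); [exact: to_one_cvg|exact: cvg_cst].
Qed.

(** The variation of [F] along the sequence of points [rs k * z].  Its finiteness is
    a measurable condition that forces convergence. *)
Definition variation (z : R[i]) : \bar R := (\sum_(0 <= k <oo)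
  `|F (rs k.+1 * complex.Re z, rs k.+1 * complex.Im z) -
    F (rs k * complex.Re z, rs k * complex.Im z)|%:E)%E.

Let variationE t : variation (cis t) = (\sum_(0 <= k <oo) (incr k t)%:E)%E.
Proof. by []. Qed.

Let good := [set t : R | (variation (cis t) < +oo)%E].

Let measurable_variation (D : set R) : measurable D ->
  measurable_fun D (fun t => variation (cis t)).
Proof.
move=> mD; have mi k : measurable_fun D (fun t => (incr k t)%:E).
  apply/measurable_EFinP; apply: measurable_funTS.
  by apply: continuous_measurable_fun; exact: incr_cont.
have i0 k t : D t -> xpredT k -> (0 <= (incr k t)%:E)%E by move=> _ _; rewrite lee_fin normr_ge0.
exact: (@ge0_emeasurable_sum _ _ R D (fun k t => (incr k t)%:E) xpredT i0 (fun k _ => mi k)).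
Qed.

Let measurable_good : measurable good.
Proof.
by rewrite -[good]setTI; apply: emeasurable_fun_infty_o => //; exact: measurable_variation.
Qed.

(** Mean square smallness gives smallness in the mean by
    [x <= 2^-k + 2^k x^2], which loses only a square root. *)
Let RI_incr k : RI (incr k) <= (2 * pi + 1) * 2^-1 ^+ k.
Proof.
have h := rs_fast k.
have ce : ebm (incr k) by apply: continuous_ebm; exact: incr_cont.
have ce2 : ebm (fun t => incr k t ^+ 2) := ebmM ce ce.
have p2 : 0 < 2 ^+ k :> R by rewrite exprn_gt0.
apply: (@le_trans _ _ (RI (fun t => 2^-1 ^+ k + 2 ^+ k * incr k t ^+ 2))).
  apply: RI_le => //; first by apply: ebmD; [exact: ebm_cst|exact: ebmZ].
  move=> t _; set x := incr k t.
  rewrite exprVn -subr_ge0.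
  have -> : (2 ^+ k)^-1 + 2 ^+ k * x ^+ 2 - x =
     2 ^+ k * ((x - (2 ^+ k)^-1 / 2) ^+ 2 + 3 / 4 * (2 ^+ k)^-1 ^+ 2).
    by field; rewrite gt_eqF.
  have q0 : 0 <= 3 / 4 :> R by lra.
  apply: mulr_ge0; first exact: ltW.
  by apply: addr_ge0; [exact: sqr_ge0|apply: mulr_ge0 => //; exact: sqr_ge0].
rewrite RI_D; [|exact: ebm_cst|exact: ebmZ].
rewrite RI_cst RI_Z// [leRHS]mulrDl lerD2l mul1r.
apply: (le_trans (ler_wpM2l (ltW p2) h)).
have h2 : 2 * 4^-1 = 2^-1 :> R by field.
by rewrite -exprMn h2.
Qed.

(** The integral of the variation is dominated by a convergent geometric series. *)
Let ae_good : {ae mu, forall t, angles t -> good t}.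
Proof.
have mv := measurable_variation (@measurable_angles R).
have hint : mu.-integrable angles (fun t => variation (cis t)).
  apply/integrableP; split => //.
  under eq_integral => t _.
    rewrite gee0_abs; last by apply: nneseries_ge0 => k _ _; rewrite lee_fin normr_ge0.
    over.
  have mi k : measurable_fun angles (fun t => (incr k t)%:E).
    apply/measurable_EFinP; apply: measurable_funTS.
    by apply: continuous_measurable_fun; exact: incr_cont.
  have i0 k t : angles t -> (0 <= (incr k t)%:E)%E by move=> _; rewrite lee_fin normr_ge0.
  rewrite (@integral_nneseries _ _ R mu angles measurable_angles (fun k t => (incr k t)%:E) mi i0).
  apply: (@le_lt_trans _ _ (\sum_(0 <= k <oo) ((2 * pi + 1) * 2^-1 ^+ k)%:E)%E).
    apply: lee_nneseries => [k _ _|k _].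
      by apply: integral_ge0 => t _; rewrite lee_fin normr_ge0.
    by rewrite RI_EFin ?lee_fin ?RI_incr//; apply: continuous_ebm; exact: incr_cont.
  have half1 : `|2^-1 : R| < 1 by rewrite ger0_norm ?invr_ge0// invf_lt1 ?ltr1n.
  have c := cvgEFin _ (@cvg_geometric_series R (2 * pi + 1) _ half1).
  have -> : (\sum_(0 <= k <oo) ((2 * pi + 1) * 2^-1 ^+ k)%:E)%E =
      ((2 * pi + 1) * (1 - 2^-1 : R)^-1)%:E; last exact: ltry.
  have E : (fun n => \sum_(0 <= k < n) ((2 * pi + 1) * 2^-1 ^+ k)%:E)%E =
      (fun n => (series (geometric (2 * pi + 1 : R) 2^-1) n)%:E).
    by apply/funext => n; rewrite seriesEnat /= sumEFin.
  by apply: cvg_lim => //; rewrite E; exact: c.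
have := @integrable_ae _ _ R mu angles (@measurable_angles R) _ hint.
apply: filterS => t h at_; rewrite /good /=.
by have := h at_; rewrite fin_numE => /andP[_]; rewrite ltey.
Qed.

(** Set to 0 on the exceptional set, so that the limits of simple maps hold at every
    point. *)
Definition radial_limit (z : R[i]) : H :=
  if (variation z < +oo)%E then
    lim (F (rs k * complex.Re z, rs k * complex.Im z) @[k --> \oo])
  else 0.

(** An absolutely convergent telescoping series. *)
Let circ_cvg t : good t -> circ k t @[k --> \oo] --> radial_limit (cis t).
Proof.
move=> gt; rewrite /radial_limit gt.
suff : cvgn (circ ^~ t) by [].
have E : circ ^~ t = fun n => circ 0 t + series (telescope (circ ^~ t)) n.
  by apply/funext => n; exact: eq_sum_telescope.
rewrite E; apply: is_cvgD; first exact: is_cvg_cst.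
apply: normed_cvg; apply: nondecreasing_is_cvgn.
  by apply: nondecreasing_series => k _ _ /=; exact: normr_ge0.
exists (fine (variation (cis t))) => _ [n _ <-].
have v0 : (0 <= variation (cis t))%E.
  by apply: nneseries_ge0 => k _ _; rewrite lee_fin normr_ge0.
have vfin : variation (cis t) \is a fin_num by rewrite ge0_fin_numE.
rewrite -lee_fin fineK// /normed_series_of /series /= -sumEFin variationE.
by apply: nneseries_lim_ge => k _ _; rewrite lee_fin normr_ge0.
Qed.

Let circ_bounded_limit t : good t -> `|radial_limit (cis t)| <= M.
Proof.
move=> gt; have c : `|circ k t| @[k --> \oo] --> `|radial_limit (cis t)|.
  by apply: cvg_norm; exact: circ_cvg.
by rewrite -(cvg_lim _ c)//; apply: limr_le; [exact: cvgP c|exact: nearW].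
Qed.

Let radial_limit_bounded t : `|radial_limit (cis t)| <= M.
Proof.
have [/circ_bounded_limit//|ng] := pselect (good t).
rewrite /radial_limit ifF ?normr0; last by apply/negP.
by apply: le_trans (circ_le 0 0).
Qed.

(** Approximate [kap F_(rs n)] within [1 / (n + 1)] by a simple map, and put 0 on the
    exceptional set. *)
Let simple_to_radial_limit (kap : R -> R) : continuous kap ->
  exists2 g_ : nat -> R -> H, (forall n, simple (g_ n)) &
  (forall t, angles t -> g_ n t @[n --> \oo] --> kap t *: radial_limit (cis t)) /\
  exists K, forall n t, angles t -> `|g_ n t| <= K.
Proof.
move=> ck.
have ckc k : continuous (fun t => kap t *: circ k t).
  by move=> t; apply: cvgZ; [exact: ck|exact: circ_cont].
have n0 n : 0 < n.+1%:R^-1 :> R by rewrite invr_gt0.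
have : forall n, exists g : R -> H, simple g /\
    forall t, angles t -> `|kap t *: circ n t - g t| < n.+1%:R^-1.
  by move=> n; have [g sg hg] := simple_approximation (ckc n) (n0 n); exists g.
move=> /choice[g hg].
exists (fun n t => if t \in ~` good then 0 else g n t).
  move=> n; apply: simple_if; last by have [] := hg n.
  exact: measurableC.
have [L kL] := continuous_bounded_angles ck.
split.
  move=> t at_; have [gt|ng] := pselect (good t); last first.
    rewrite (mem_set (A := ~` good))//.
    rewrite /radial_limit ifF ?scaler0; last by apply/negP.
    exact: cvg_cst.
  have -> : (fun n => if t \in ~` good then 0 else g n t) = g ^~ t.
    by rewrite memNset// => /(_ gt).
  have cc : kap t *: circ n t @[n --> \oo] --> kap t *: radial_limit (cis t).
    by apply: cvgZ; [exact: cvg_cst|exact: circ_cvg].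
  have dd : kap t *: circ n t - g n t @[n --> \oo] --> (0 : H).
    apply: norm_cvg0; apply: (@squeeze_cvgr _ _ _ _ (fun=> 0) (fun n => n.+1%:R^-1)).
    - by apply: nearW => n; rewrite normr_ge0 ltW//; apply: (hg n).2.
    - exact: cvg_cst.
    - exact: cvg_harmonic.
  have -> : kap t *: radial_limit (cis t) = kap t *: radial_limit (cis t) - 0 by rewrite subr0.
  have -> : g ^~ t = fun n => kap t *: circ n t - (kap t *: circ n t - g n t).
    by apply/funext => n; rewrite opprB addrCA subrr addr0.
  exact: cvgB.
exists (L * M + 1) => n t at_; case: ifP => _.
  have L0 : 0 <= L by apply: le_trans (kL t at_).
  have M0 : 0 <= M by apply: le_trans (circ_le 0 0).
  by rewrite normr0 addr_ge0// mulr_ge0.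
have -> : g n t = kap t *: circ n t - (kap t *: circ n t - g n t).
  by rewrite opprB addrCA subrr addr0.
rewrite (le_trans (ler_normB _ _))// lerD//.
  by rewrite normrZ ler_pM// kL.
apply: ltW; apply: (lt_le_trans ((hg n).2 t at_)).
by rewrite invf_le1 ?ler1n// ltr0n.
Qed.

Let radial_limit_ebm h : ebm (fun t => ip (radial_limit (cis t)) h).
Proof.
have [g_ sg [gl _]] := simple_to_radial_limit (@cst_continuous _ _ (1 : R)).
apply: (@bounded_ebm _ _ (M * `|h|)).
  apply: (@strongly_measurable_continuous _ _ (fun t => radial_limit (cis t)) (ip^~ h)).
    by exists g_; split => // t /gl; rewrite scale1r.
  exact: (ip_continuousl hip).
by move=> t _; rewrite (le_trans (ip_CS hip _ _))// ler_wpM2r.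
Qed.

(** On the circles of radii [rs k] the Poisson formula reads
    [F(rs k r e^(i theta)) = P[F_(rs k)](r e^(i theta))]; let [k] tend to infinity,
    by bounded convergence on one side and by continuity of [F] on the other. *)
Lemma radial_limit_boundary_fun : boundary_fun F radial_limit.
Proof.
split; first split.
- have [g_ sg [gl _]] := simple_to_radial_limit (@cst_continuous _ _ (1 : R)).
  by exists g_; split => // t /gl; rewrite scale1r.
- by exists M; apply: aeW => t _; exact: radial_limit_bounded.
move=> r theta r01.
have ck : continuous (fun t => (2 * pi)^-1 * poisson_kernel r theta t).
  by move=> t; apply: cvgM; [exact: cvg_cst|exact: continuous_poisson_kernel].
have [g_ sg [gl [K gK]]] := simple_to_radial_limit ck.
apply: (bochner_integral_intro hip sg gl gK) => h.
have pi0 : 2 * pi != 0 :> R by rewrite gt_eqF// mulr_gt0 ?pi_gt0.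
have ek : ebm (poisson_kernel r theta).
  by apply: continuous_ebm; exact: continuous_poisson_kernel.
have er := radial_limit_ebm h.
have -> : RI (fun t => ip (((2 * pi)^-1 * poisson_kernel r theta t) *: radial_limit (cis t)) h) =
    (2 * pi)^-1 * RI (fun t => poisson_kernel r theta t * ip (radial_limit (cis t)) h).
  rewrite -RI_Z; last exact: ebmM.
  by apply: eq_RI => t _; rewrite ipZl mulrA.
apply: (mulfI pi0); rewrite mulrA divff// mul1r.
have [L kL] := continuous_bounded_angles (@continuous_poisson_kernel R r theta r01).
have c1 : RI (fun t => poisson_kernel r theta t * ip (circ k t) h) @[k --> \oo] -->
    RI (fun t => poisson_kernel r theta t * ip (radial_limit (cis t)) h).
  apply: (@RI_cvg _ _ _ (L * (M * `|h|))).
  - move=> k; have [] // : ebm (fun t => poisson_kernel r theta t * ip (circ k t) h).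
    by apply: ebmM => //; apply: continuous_ebm; exact: (circle_ip_continuous hip hF (rs01 k)).
  - exact: ebmM.
  - move=> k t at_; rewrite normrM ler_pM ?kL//.
    by rewrite (le_trans (ip_CS hip _ _))// ler_wpM2r.
  - apply: filterS ae_good => t gt at_; apply: cvgM; first exact: cvg_cst.
    by apply: (ip_cvg hip); [exact: circ_cvg (gt at_)|exact: cvg_cst].
have E : (fun k => RI (fun t => poisson_kernel r theta t * ip (circ k t) h)) =
    (fun k => 2 * pi * ip (F (pt (rs k * r) theta)) h).
  by apply/funext => k; exact: (poisson_formula hip hF).
rewrite E in c1.
suff c2 : 2 * pi * ip (F (pt (rs k * r) theta)) h @[k --> \oo] -->
    2 * pi * ip (F (pt r theta)) h by exact: (cvg_unique _ c1 c2).
apply: cvgM; first exact: cvg_cst.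
have cz : {for pt r theta, continuous (fun z => ip (F z) h)}.
  apply: (ip_continuous_at hip); last exact: cvg_cst.
  by apply: (harmonic_continuous hF); exact: disk_polar.
have c0 : rs k * r @[k --> \oo] --> r.
  by rewrite -[X in _ --> X]mul1r; apply: cvgM; [exact: rs_cvg|exact: cvg_cst].
apply: (@continuous2_cvg _ _ _ _ _ _ (fun k => rs k * r * cos theta)
  (fun k => rs k * r * sin theta) (fun x y => ip (F (x, y)) h)
  (r * cos theta) (r * sin theta)).
- by have <- : (fun z : R * R => ip (F z) h) = (fun z => ip (F (z.1, z.2)) h) by apply/funext => -[].
- by apply: cvgM; [exact: c0|exact: cvg_cst].
- by apply: cvgM; [exact: c0|exact: cvg_cst].
Qed.

End Fatou.

Theorem bounded_harmonic_boundary_fun (R : realType) (H : completeNormedModType R)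
    (ip : {dot H for @idfun R}) (hip : induces_norm ip) (F : R * R -> H) (M : R) :
  Defs.harmonic F -> (forall z, disk z -> `|F z| <= M) ->
  exists Phi, boundary_fun F Phi.
Proof.
move=> hF hM; have [rs hrs] := fast_radii hip hF hM.
exists (radial_limit F rs).
by apply: (@radial_limit_boundary_fun R H ip hip F M hF hM rs) => k; have [] := hrs k.
Qed.

(** * Normalization by an isometry of the plane *)

Section Locality.
Context {R : realType} {V W : normedModType R}.

(** Differentiability is local; the derivatives of [F] composed with an isometry
    are only known on the disk. *)
Lemma near_eq_differentiable (f g : V -> W) (x : V) :
  (\near x, f x = g x) -> differentiable g x -> differentiable f x.
Proof.
move=> fg dg.
have fgx : f x = g x := nbhs_singleton fg.
have e : f \o shift x = cst (f x) + 'd g x +o_ 0 id.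
  have := diff_locally dg => /eqaddoP h; apply/eqaddoP => eps eps0.
  have fg0 : \forall h \near (0 : V), f (h + x) = g (h + x).
    have : (fun h : V => h + x) @ (0 : V) --> x.
      rewrite -[X in _ --> X]add0r.
      by apply: cvgD; [exact: cvg_id|exact: cvg_cst].
    by move=> /(_ _ fg).
  apply: filterS2 fg0 (h _ eps0) => k fgk.
  by rewrite /= !fctE /= fgk fgx.
have cg := diff_continuous dg.
have dE : 'd f x = 'd g x :> (V -> W) by exact: diff_unique.
by apply/diff_locallyP; rewrite dE.
Qed.

End Locality.

Section Rotation.
Context {R : realType} {H : completeNormedModType R}.
Variable ip : {dot H for @idfun R}.
Hypothesis hip : induces_norm ip.

Lemma opnorm_conformal (A : R * R -> H) (lam : R) :
  (forall v, `|A v| = lam * enorm v) -> 0 < lam -> opnorm A = lam.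
Proof.
move=> hA lam0; have e1 : enorm (ex : R * R) = 1.
  by rewrite /enorm /= expr1n expr0n addr0 sqrtr1.
apply/eqP; rewrite eq_le; apply/andP; split.
  apply: ge_sup; first by exists `|A ex|, ex => //=; rewrite e1.
  by move=> _ [v /= v1 <-]; rewrite hA ler_piMr// ltW.
apply: sup_upper_bound.
  split; first by exists `|A ex|, ex => //=; rewrite e1.
  by exists lam => _ [v /= v1 <-]; rewrite hA ler_piMr// ltW.
by exists ex; rewrite /= ?hA e1 ?mulr1.
Qed.

(** The rows of an orthogonal 2 x 2 matrix are orthonormal when its columns are. *)
Lemma orthogonal_transpose (al be ga de : R) :
  al ^+ 2 + be ^+ 2 = 1 -> ga ^+ 2 + de ^+ 2 = 1 -> al * ga + be * de = 0 ->
  [/\ al ^+ 2 + ga ^+ 2 = 1, be ^+ 2 + de ^+ 2 = 1 & al * be + ga * de = 0].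
Proof.
move=> h1 h2 h3; pose k := al * de - be * ga.
(* k is the determinant; the second vector is k times the first one turned by a
   right angle. *)
have gE : ga = - be * k.
  transitivity ((al ^+ 2 + be ^+ 2) * ga - al * (al * ga + be * de)).
    by rewrite h1 h3 mulr0 subr0 mul1r.
  by rewrite /k; ring.
have dE : de = al * k.
  transitivity ((al ^+ 2 + be ^+ 2) * de - be * (al * ga + be * de)).
    by rewrite h1 h3 mulr0 subr0 mul1r.
  by rewrite /k; ring.
have k2 : k ^+ 2 = 1.
  rewrite -h2 gE dE; transitivity ((al ^+ 2 + be ^+ 2) * k ^+ 2); last by ring.
  by rewrite h1 mul1r.
clearbody k; split.
- by rewrite gE -h1; transitivity (al ^+ 2 + be ^+ 2 * k ^+ 2); [ring|rewrite k2 mulr1].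
- by rewrite dE -h1; transitivity (be ^+ 2 + al ^+ 2 * k ^+ 2); [ring|rewrite k2 mulr1 addrC].
- by rewrite gE dE; transitivity (al * be * (1 - k ^+ 2)); [ring|rewrite k2 subrr mulr0].
Qed.

Lemma disk_open : open (disk : set (R * R)).
Proof.
rewrite /disk.
have -> : [set z : R * R | enorm z < 1] = (@enorm R) @^-1` [set x | x < 1] by [].
apply: open_comp; last exact: open_lt.
move=> z _; apply: (@continuous_comp _ _ _ (fun z : R * R => z.1 ^+ 2 + z.2 ^+ 2) (@Num.sqrt R)).
  by apply: cvgD; apply: (@cvg_comp _ _ _ _ (fun x : R => x ^+ 2));
    [exact: cvg_fst|exact: exprn_continuous|exact: cvg_snd|exact: exprn_continuous].
exact: sqrt_continuous.
Qed.

Variables (F : R * R -> H) (v1 v2 : R * R).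
Hypothesis hF : Defs.harmonic F.
Hypothesis v11 : v1.1 ^+ 2 + v1.2 ^+ 2 = 1.
Hypothesis v22 : v2.1 ^+ 2 + v2.2 ^+ 2 = 1.
Hypothesis v12 : v1.1 * v2.1 + v1.2 * v2.2 = 0.

Definition frame (z : R * R) : R * R := z.1 *: v1 + z.2 *: v2.

Lemma frame_linear : linear frame.
Proof.
move=> k x y; rewrite /frame /= scalerDr !scalerDl !scalerA addrACA.
by [].
Qed.

HB.instance Definition _ := GRing.isLinear.Build R (R * R)%type (R * R)%type _ frame frame_linear.

Lemma frame_continuous : continuous frame.
Proof.
move=> z; apply: cvgD; apply: cvgZr_tmp; [exact: cvg_fst|exact: cvg_snd].
Qed.

Lemma enorm_frame z : enorm (frame z) = enorm z.
Proof.
rewrite /enorm /frame /=; congr Num.sqrt.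
rewrite /GRing.scale /=.
transitivity (z.1 ^+ 2 * (v1.1 ^+ 2 + v1.2 ^+ 2) + z.2 ^+ 2 * (v2.1 ^+ 2 + v2.2 ^+ 2)
  + 2 * z.1 * z.2 * (v1.1 * v2.1 + v1.2 * v2.2)); first by ring.
by rewrite v11 v22 v12 !mulr1 mulr0 addr0.
Qed.

Lemma disk_frame z : disk z -> disk (frame z).
Proof. by rewrite /disk /= enorm_frame. Qed.

Lemma frame_differentiable z : differentiable frame z.
Proof. exact: (linear_differentiable _ frame_continuous). Qed.

Lemma frame_diff z : 'd frame z = frame :> (R * R -> R * R).
Proof. exact: (diff_lin _ frame_continuous). Qed.

Lemma derive_frame (G : R * R -> H) z v : differentiable G (frame z) ->
  'D_v (G \o frame) z = 'D_(frame v) G (frame z).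
Proof.
move=> dG; have d : differentiable (G \o frame) z.
  by apply: differentiable_comp => //; exact: frame_differentiable.
have E : 'd (G \o frame) z v = 'd G (frame z) ('d frame z v).
  have h := diff_comp (frame_differentiable z) dG.
  have h2 := congr1 (fun f => f v) h.
  exact: h2.
have fv : 'd frame z v = frame v := congr1 (fun f => f v) (frame_diff z).
apply: (eq_trans (deriveE v d)); apply: (eq_trans E).
apply: (eq_trans _ (esym (deriveE (frame v) dG))).
exact: (congr1 (fun w => 'd G (frame z) w) fv).
Qed.

Lemma near_disk (z : R * R) : disk z -> \forall y \near z, disk y.
Proof. by move=> z1; apply: open_nbhs_nbhs; split => //; exact: disk_open. Qed.

Lemma derive_coord (G : R * R -> H) (z v : R * R) : differentiable G z ->
  'D_v G z = v.1 *: 'D_ex G z + v.2 *: 'D_ey G z.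
Proof.
move=> dG; apply: (eq_trans (deriveE v dG)).
have -> : v = v.1 *: ex + v.2 *: ey.
  case: v => a b; rewrite /ex /ey; congr (_, _);
  by rewrite /= /GRing.scale/= !(mulr1, mulr0, addr0, add0r).
rewrite linearD !linearZ.
have e1 := deriveE ex dG; have e2 := deriveE ey dG.
by rewrite -e1 -e2 /= /GRing.scale /= !(mulr1, mulr0, addr0, add0r).
Qed.

Let dF z : disk z -> differentiable F z.
Proof. by move=> /(proj1 hF)[]. Qed.

Let dFv v z : disk z -> differentiable ('D_v F) z.
Proof. by move=> /(proj1 hF)[_ /(_ v)[]]. Qed.

Let F' := F \o frame.

Let near_derive v z : disk z ->
  \forall y \near z, 'D_v F' y = ('D_(frame v) F \o frame) y.
Proof.
move=> /near_disk; apply: filterS => y y1; apply: derive_frame.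
by apply: dF; exact: disk_frame.
Qed.

Let derive2_frame v w z : disk z ->
  'D_w ('D_v F') z = 'D_(frame w) ('D_(frame v) F) (frame z).
Proof.
move=> z1; rewrite (near_eq_derive w (near_derive v z1)); apply: derive_frame.
by apply: dFv; exact: disk_frame.
Qed.

Lemma derive2_coord v z : disk z -> 'D_v ('D_v F) z =
  v.1 *: (v.1 *: 'D_ex ('D_ex F) z + v.2 *: 'D_ey ('D_ex F) z) +
  v.2 *: (v.1 *: 'D_ex ('D_ey F) z + v.2 *: 'D_ey ('D_ey F) z).
Proof.
move=> z1.
have e : \forall y \near z, 'D_v F y = (v.1 *: 'D_ex F + v.2 *: 'D_ey F) y.
  by move: (near_disk z1); apply: filterS => y y1; exact: (derive_coord v (dF y1)).
apply: (eq_trans (near_eq_derive v e)).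
have dx := diff_derivable (v := v) (dFv ex z1); have dy := diff_derivable (v := v) (dFv ey z1).
have dx' : derivable (v.1 *: 'D_ex F) z v := derivableZ dx.
have dy' : derivable (v.2 *: 'D_ey F) z v := derivableZ dy.
apply: (eq_trans (deriveD dx' dy')).
have ex1 := deriveZ v.1 dx; have ey1 := deriveZ v.2 dy.
have ex2 := derive_coord v (dFv ex z1); have ey2 := derive_coord v (dFv ey z1).
exact: (f_equal2 +%R (eq_trans ex1 (congr1 ( *:%R v.1) ex2))
  (eq_trans ey1 (congr1 ( *:%R v.2) ey2))).
Qed.

Lemma frame_ex : frame ex = v1.
Proof. by rewrite /frame /= scale1r scale0r addr0. Qed.

Lemma frame_ey : frame ey = v2.
Proof. by rewrite /frame /= scale1r scale0r add0r. Qed.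

(** The second derivatives along [v1] and [v2] add up to the Laplacian since
    [(v1, v2)] is orthonormal. *)
Lemma harmonic_frame : Defs.harmonic (F \o frame).
Proof.
split=> [z z1|z z1].
  split.
    by apply: differentiable_comp; [exact: frame_differentiable|exact: dF (disk_frame z1)].
  move=> v; split.
    apply: (near_eq_differentiable (near_derive v z1)).
    apply: differentiable_comp; first exact: frame_differentiable.
    exact: dFv (disk_frame z1).
  move=> w.
  have [_ /(_ (frame v))[_ /(_ (frame w)) c]] := proj1 hF _ (disk_frame z1).
  have e : \forall y \near z, 'D_(frame w) ('D_(frame v) F) (frame y) = 'D_w ('D_v F') y.
    by move: (near_disk z1); apply: filterS => y y1; rewrite derive2_frame.
  have c' : 'D_(frame w) ('D_(frame v) F) (frame y) @[y --> z] -->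
      'D_(frame w) ('D_(frame v) F) (frame z).
    by apply: (@cvg_comp _ _ _ frame ('D_(frame w) ('D_(frame v) F)) _ (nbhs (frame z)));
      [exact: frame_continuous|exact: c].
  have ez := nbhs_singleton e.
  suff h : 'D_w ('D_v F') y @[y --> z] --> 'D_(frame w) ('D_(frame v) F) (frame z).
    by move: h; rewrite {}ez.
  by apply: cvg_trans c'; exact: near_eq_cvg.
have z1' := disk_frame z1.
rewrite /laplacian (derive2_frame ex ex z1) (derive2_frame ey ey z1).
rewrite frame_ex frame_ey (derive2_coord v1 z1') (derive2_coord v2 z1').
have lapz : 'D_ex ('D_ex F) (frame z) + 'D_ey ('D_ey F) (frame z) = 0 := proj2 hF _ z1'.
have [t1 t2 t3] := orthogonal_transpose v11 v22 v12.
move: lapz; move: ('D_ex ('D_ex F) _) ('D_ey ('D_ex F) _) ('D_ex ('D_ey F) _) ('D_ey ('D_ey F) _).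
move=> A B C D AD.
transitivity ((v1.1 ^+ 2 + v2.1 ^+ 2) *: A + (v1.1 * v1.2 + v2.1 * v2.2) *: B +
  (v1.1 * v1.2 + v2.1 * v2.2) *: C + (v1.2 ^+ 2 + v2.2 ^+ 2) *: D).
  apply: (ip_ext hip) => h; rewrite !(ipDl, ipZl).
  by move: (ip A h) (ip B h) (ip C h) (ip D h) => a b c d; ring.
by rewrite t1 t2 t3 !scale0r !scale1r !addr0.
Qed.

Lemma dF0_frame v : dF0 (F \o frame) v = dF0 F (frame v).
Proof.
have f0 : frame 0 = 0 by rewrite /frame /= !scale0r addr0.
have d0 : disk (0 : R * R) by rewrite /disk /= /enorm /= expr0n addr0 sqrtr0.
have dG : differentiable F (frame 0) by rewrite f0; exact: dF.
have fv : 'd frame 0 v = frame v := congr1 (fun f => f v) (frame_diff 0).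
have h := congr1 (fun f => f v) (diff_comp (frame_differentiable 0) dG).
apply: (eq_trans h).
apply: (eq_trans (congr1 (fun w => 'd F (frame 0) w) fv)).
by rewrite /dF0 f0.
Qed.

End Rotation.

Section Normalization.
Context {R : realType} {H : completeNormedModType R}.
Variable ip : {dot H for @idfun R}.
Hypothesis hip : induces_norm ip.

(** Take for [v1] and [v2] the preimages of [lam e1] and [lam e2] under the conformal
    [dF_0]: they are orthonormal, and precomposition with their frame makes
    [dF_0] send the standard basis to [lam e1] and [lam e2]. *)
Lemma class_normalize (F : R * R -> H) (G L : set H) (p e1 e2 : H) :
  classF G p L F -> orthonormal_basis ip L e1 e2 ->
  exists2 F' : R * R -> H, classFn G p L e1 e2 F' & opnorm (dF0 F') = opnorm (dF0 F).
Proof.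
move=> [[hF FG F0] [nz [lam lam0 cF] rF]] [e11 e22 e12 LE].
have Le1 : L (lam *: e1) by rewrite LE; exists lam, 0; rewrite scale0r addr0.
have Le2 : L (lam *: e2) by rewrite LE; exists 0, lam; rewrite scale0r add0r.
have [v1 _ hv1] : range (dF0 F) (lam *: e1) by rewrite rF.
have [v2 _ hv2] : range (dF0 F) (lam *: e2) by rewrite rF.
(* Conformality turns orthonormality of e1 and e2 into that of v1 and v2. *)
have sq v x y : dF0 F v = lam *: (x *: e1 + y *: e2) -> v.1 ^+ 2 + v.2 ^+ 2 = x ^+ 2 + y ^+ 2.
  move=> hv; have l2 : lam ^+ 2 != 0 by rewrite expf_neq0// gt_eqF.
  apply: (mulfI l2).
  have <- : `|dF0 F v| ^+ 2 = lam ^+ 2 * (v.1 ^+ 2 + v.2 ^+ 2).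
    by rewrite cF exprMn sqr_sqrtr// addr_ge0 ?sqr_ge0.
  rewrite hv normrZ exprMn real_normK ?num_real// -hip; congr (_ * _).
  by rewrite !(ipDl, ipDr, ipZl, ipZr) e11 e22 e12 (ipC ip e2) e12; ring.
have v11 : v1.1 ^+ 2 + v1.2 ^+ 2 = 1.
  by rewrite (sq _ 1 0) ?expr1n ?expr0n ?addr0// scale1r scale0r addr0.
have v22 : v2.1 ^+ 2 + v2.2 ^+ 2 = 1.
  by rewrite (sq _ 0 1) ?expr1n ?expr0n ?add0r// scale1r scale0r add0r.
have v12 : v1.1 * v2.1 + v1.2 * v2.2 = 0.
  have := sq (v1 + v2) 1 1.
  have -> : dF0 F (v1 + v2) = lam *: (1 *: e1 + 1 *: e2).
    by rewrite /dF0 linearD -!/(dF0 F _) hv1 hv2 !scale1r scalerDr.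
  move=> /(_ erefl) /= h.
  have : 2 * (v1.1 * v2.1 + v1.2 * v2.2) = 0.
    transitivity ((v1.1 + v2.1) ^+ 2 + (v1.2 + v2.2) ^+ 2 -
      (v1.1 ^+ 2 + v1.2 ^+ 2) - (v2.1 ^+ 2 + v2.2 ^+ 2)); first by ring.
    by rewrite h v11 v22; ring.
  by move/eqP; rewrite mulf_eq0 pnatr_eq0 /= => /eqP.
pose F' := F \o frame v1 v2.
have fE v : dF0 F' v = dF0 F (frame v1 v2 v) := dF0_frame v1 v2 hF v.
have cF' v : `|dF0 F' v| = lam * enorm v.
  by rewrite fE cF (enorm_frame v11 v22 v12).
have hF' := harmonic_frame hip hF v11 v22 v12.
have d0 : disk (0 : R * R) by rewrite /disk /= /enorm /= expr0n addr0 sqrtr0.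
have dF' : differentiable F' 0 by have [] := proj1 hF' 0 d0.
have nE : opnorm (dF0 F') = lam := opnorm_conformal cF' lam0.
exists F'; last by rewrite nE (opnorm_conformal cF lam0).
have x1 : 'D_ex F' 0 = lam *: e1.
  by rewrite (deriveE ex dF') -/(dF0 F' ex) fE frame_ex.
have y1 : 'D_ey F' 0 = lam *: e2.
  by rewrite (deriveE ey dF') -/(dF0 F' ey) fE frame_ey.
split; last by rewrite nE.
split; split.
- exact: hF'.
- by move=> z z1; apply: FG; exact: (disk_frame v11 v22 v12).
- by rewrite /F' /= /frame /= !scale0r addr0.
- exists ex; rewrite -normr_gt0 cF' mulr_gt0//.
  by rewrite /enorm /= expr1n expr0n addr0 sqrtr1.
- by exists lam.
apply/seteqP; split => [_ [v _ <-]|w].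
  by rewrite fE -rF; exists (frame v1 v2 v).
rewrite LE => -[x [y ->]]; exists (x / lam *: ex + y / lam *: ey) => //.
have lin : dF0 F' (x / lam *: ex + y / lam *: ey) =
    (x / lam) *: dF0 F' ex + (y / lam) *: dF0 F' ey by rewrite /dF0 linearD !linearZ.
by rewrite lin !fE frame_ex frame_ey hv1 hv2 !scalerA !divfK ?gt_eqF.
Qed.

End Normalization.

(** * The two extremal problems *)

Section AffineEreal.
Context {R : realType}.
Implicit Types (c k : R) (x : \bar R).

Definition eaffine c k x : \bar R := (c%:E * x + k%:E)%E.

(** This inverse transports limits and attained suprema back, infinite values
    included. *)
Lemma eaffineK c k : 0 < c -> cancel (eaffine c k) (eaffine c^-1 (- (c^-1 * k))).
Proof.
move=> c0 [x| |]; rewrite /eaffine.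
- by rewrite -!EFinM -!EFinD; congr EFin; field; rewrite gt_eqF.
- by rewrite gt0_muley ?lte_fin// addye// gt0_muley ?lte_fin ?invr_gt0// addye.
- by rewrite gt0_muleNy ?lte_fin// addNye gt0_muleNy ?lte_fin ?invr_gt0// addNye.
Qed.

Lemma eaffine_le c k x y : 0 < c -> (x <= y)%E -> (eaffine c k x <= eaffine c k y)%E.
Proof. by move=> c0 xy; rewrite leeD2r// lee_pmul2l. Qed.

Lemma eaffine_cvg c k (u : (\bar R)^nat) (l : \bar R) :
  u n @[n --> \oo] --> l -> eaffine c k (u n) @[n --> \oo] --> eaffine c k l.
Proof.
move=> ul; apply: cvgeD; last exact: cvg_cst.
  by rewrite fin_num_adde_defl.
exact: cvgeZl.
Qed.

Lemma ereal_sup_affine c k (A : set R) : 0 < c ->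
  ereal_sup [set (c * x + k)%:E | x in A] = eaffine c k (ereal_sup [set x%:E | x in A]).
Proof.
move=> c0; apply/eqP; rewrite eq_le; apply/andP; split.
  apply: ge_ereal_sup => _ [x Ax <-].
  rewrite (_ : (c * x + k)%:E = eaffine c k x%:E)//.
  by apply: eaffine_le => //; apply: ereal_sup_ubound; exists x.
have c1 : 0 < c^-1 by rewrite invr_gt0.
rewrite -[leRHS](eaffineK (- (c^-1 * k)) c1) invrK mulrN mulrA divff ?gt_eqF// mul1r opprK.
apply: eaffine_le => //; apply: ge_ereal_sup => _ [x Ax <-].
rewrite -(eaffineK k c0 x%:E); apply: eaffine_le => //.
by apply: ereal_sup_ubound; exists x.
Qed.

End AffineEreal.

Theorem theorem4p2 (R : realType) (H : completeNormedModType R)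
    (ip : {dot H for @idfun R}) (hip : induces_norm ip)
    (G : set H) (hG : bounded_domain G) (p : H) (hp : G p)
    (L : set H) (hL : lin_plane L)
    (pL pT : H) (hdec : p = pL + pT) (hpL : L pL)
    (hpT : forall v, L v -> ip pT v = 0)
    (a b : R) (ha : a = `|pL|) (hb : b = `|pT|)
    (c : R) (hc : 0 < c)
    (hslice : G `&` [set p + v | v in L] =
              [set pT + v | v in L `&` [set v | `|v| < c]])
    (s : R) (hs : s = a / c)
    (e1 e2 : H) (he : orthonormal_basis ip L e1 e2) (hpe : pL = a *: e1) :
  let Fn := classFn G p L e1 e2 in
  let M := M_sup G p L in
  let I := I_pairing ip pT e1 e2 s c in
  let sigma := sigma_sup ip G p L pT e1 e2 s c in
  let N := fun F : R * R -> H => opnorm (dF0 F) in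
  let K := 2 * c * s * a + (1 + s ^+ 2) * b ^+ 2 in
  (forall F Phi, Fn F -> boundary_fun F Phi -> I Phi = c * N F + K) /\
  (sigma = c%:E * M + K%:E)%E /\
  (forall F1 F2 Phi1 Phi2, Fn F1 -> Fn F2 ->
     boundary_fun F1 Phi1 -> boundary_fun F2 Phi2 ->
     (N F1 <= N F2 <-> I Phi1 <= I Phi2)) /\
  (forall (F_ : nat -> R * R -> H) (Phi_ : nat -> R[i] -> H),
     (forall j, Fn (F_ j)) -> (forall j, boundary_fun (F_ j) (Phi_ j)) ->
     ((N (F_ j))%:E @[j --> \oo] --> M <->
      (I (Phi_ j))%:E @[j --> \oo] --> sigma)) /\
  (forall F Phi, Fn F -> boundary_fun F Phi ->
     ((N F)%:E = M <-> (I Phi)%:E = sigma)).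
Proof.
move=> Fn M I sigma N K.
have [e11 e22 e12 LE] := he.
have Le1 : L e1 by rewrite LE; exists 1, 0; rewrite scale1r scale0r addr0.
have Le2 : L e2 by rewrite LE; exists 0, 1; rewrite scale1r scale0r add0r.
have L0 : L 0 by rewrite LE; exists 0, 0; rewrite !scale0r addr0.
(* p itself lies in the slice, hence a < c. *)
have s01 : 0 <= s < 1.
  have : (G `&` [set p + v | v in L]) p by split => //; exists 0 => //; rewrite addr0.
  rewrite hslice => -[v [_ /= vc] vE].
  have vpL : v = pL by apply: (addrI pT); rewrite vE hdec addrC.
  by rewrite hs divr_ge0 ?ha ?(ltW hc)//= ltr_pdivrMr// mul1r -vpL.
have key F Phi : Fn F -> boundary_fun F Phi -> I Phi = c * N F + K.
  move=> [[[hF FG F0] _] [N0 Fx Fy]] FPhi.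
  have d0 : disk (0 : R * R) by rewrite /disk /= /enorm /= expr0n addr0 sqrtr0.
  have dF : differentiable F 0 by have [] := proj1 hF 0 d0.
  have F0' : F 0 = a *: e1 + pT by rewrite F0 hdec hpe.
  rewrite /I (pairing_identity hip c FPhi dF F0' Fx Fy e11 e22 (hpT _ Le1) (hpT _ Le2) s01).
  by rewrite /K hip hb.
have bdd F : classF G p L F -> exists Phi, boundary_fun F Phi.
  move=> [[hF FG _] _]; have [_ _ _ [B [_ hB]]] := hG.
  apply: (bounded_harmonic_boundary_fun (M := B + 1) hip hF) => z z1.
  by apply: (hB (B + 1)); [rewrite ltrDl|exact: FG].
have sE : sigma = eaffine c K M.
  rewrite /M /M_sup.
  have -> : [set (opnorm (dF0 F))%:E | F in classF G p L] =
      [set x%:E | x in [set N F | F in classF G p L]].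
    by rewrite -image_comp.
  rewrite -ereal_sup_affine//; congr ereal_sup; apply/seteqP; split.
    move=> _ [F [Phi [hFn FPhi ->]]]; exists (N F); first by exists F => //; case: hFn.
    exact: (congr1 EFin (esym (key F Phi hFn FPhi))).
  move=> _ [_ [F hF <-] <-].
  have [F' hF' NE] := class_normalize hip hF he.
  have [Phi FPhi] := bdd F' (proj1 hF').
  exists F', Phi; split; [exact: hF'|exact: FPhi|].
  have e : c * N F + K = I Phi.
    exact: (esym (eq_trans (key F' Phi hF' FPhi) (congr1 (fun n => c * n + K) NE))).
  exact: (congr1 EFin e).
have IE F Phi : Fn F -> boundary_fun F Phi -> (I Phi)%:E = eaffine c K (N F)%:E.
  by move=> hF FPhi; exact: (congr1 EFin (key F Phi hF FPhi)).
split; first exact: key.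
split; first exact: sE.
split.
  move=> F1 F2 Phi1 Phi2 h1 h2 b1 b2.
  rewrite (key F1 Phi1 h1 b1) (key F2 Phi2 h2 b2) lerD2r (ler_pM2l hc).
  exact: iff_refl.
split.
  move=> F_ Phi_ hF_ hPhi_; rewrite sE.
  have E : (fun j => (I (Phi_ j))%:E) = (fun j => eaffine c K (N (F_ j))%:E).
    by apply/funext => j; exact: (IE _ _ (hF_ j) (hPhi_ j)).
  rewrite E; split; first exact: eaffine_cvg.
  move=> /(@eaffine_cvg _ c^-1 (- (c^-1 * K)) _ _); rewrite (eaffineK K hc).
  by under eq_fun do rewrite (eaffineK K hc).
move=> F Phi hF FPhi; rewrite (IE F Phi hF FPhi) sE; split; first exact: congr1.
exact: (can_inj (eaffineK K hc)).
Qed.
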